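(* Let $(\Omega,\mathcal{H},\hat{E})$ be a sublinear expectation space and let $\{X_i\}_{i=1}^{\infty}$ be a sequence of $\mathbb{R}^d$-valued random variables in it satisfying the following conditions: (i) for every $i\ge 1$, $X_{i+1}$ is independent from $(X_1,\ldots,X_i)$; (ii) $\hat{E}[X_i]=\hat{E}[-X_i]=0$ for every $i\ge 1$ (componentwise); (iii) there is a constant $M>0$ such that $\hat{E}[|X_i|^3]\le M$ for all $i\ge 1$; (v) there exists a sublinear function $G:\mathbb{S}(d)\to\mathbb{R}$ such that $\lim_{i\to\infty}G_i(A)=G(A)$ for every $A\in\mathbb{S}(d)$, where $G_i(A)=\frac12\hat{E}[\langle AX_i,X_i\rangle]$. Let $S_n=X_1+\cdots+X_n$. Then $\{S_n/\sqrt{n}\}_{n=1}^\infty$ converges in law to the $G$-normal distribution $N(0;\Theta)$, i.e. $$\lim_{n\to\infty}\hat{E}\left[\varphi\left(\frac{S_n}{\sqrt n}\right)\right]=\hat{E}[\varphi(X)]\quad\text{for all }\varphi\in C_{b,Lip}(\mathbb{R}^d),$$ where $X\sim N(0;\Theta)$ is the $G$-normal distributed random vector associated with $G$.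
   Context: Sublinear expectation space: $\Omega$ is a set and $\mathcal{H}$ is a linear space of real functions on $\Omega$ containing the constants, closed under $X\mapsto|X|$, and such that $\varphi(X_1,\ldots,X_n)\in\mathcal{H}$ whenever $X_1,\ldots,X_n\in\mathcal{H}$ and $\varphi\in C_{l,Lip}(\mathbb{R}^n)$. Here $C_{l,Lip}(\mathbb{R}^n)$ is the space of $\varphi:\mathbb{R}^n\to\mathbb{R}$ with $|\varphi(x)-\varphi(y)|\le C(1+|x|^m+|y|^m)|x-y|$ for all $x,y$, for some $C>0$, $m\in\mathbb{N}$ depending on $\varphi$; $C_{b,Lip}(\mathbb{R}^n)$ is the space of bounded Lipschitz functions. A sublinear expectation is a functional $\hat{E}:\mathcal{H}\to\mathbb{R}$ that is monotone ($X\ge Y\Rightarrow\hat{E}[X]\ge\hat{E}[Y]$), constant preserving ($\hat{E}[c]=c$), sub-additive ($\hat{E}[X+Y]\le\hat{E}[X]+\hat{E}[Y]$) and positively homogeneous ($\hat{E}[\lambda X]=\lambda\hat{E}[X]$, $\lambda\ge0$). An $\mathbb{R}^d$-valued random variable is an element of $\mathcal{H}^d$. Independence: $Y\in\mathcal{H}^n$ is independent from $X\in\mathcal{H}^m$ if $\hat{E}[\varphi(X,Y)]=\hat{E}\big[\hat{E}[\varphi(x,Y)]|_{x=X}\big]$ for all $\varphi\in C_{l,Lip}(\mathbb{R}^{n+m})$. Random vectors $X_1,X_2$ in $\mathbb{R}^n$ (possibly on different spaces with expectations $E_1,E_2$) are identically distributed, $X_1\sim X_2$, if $E_1[\varphi(X_1)]=E_2[\varphi(X_2)]$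 for all $\varphi\in C_{b,Lip}(\mathbb{R}^n)$. An independent copy $\bar X$ of $X$ is a random vector with $\bar X\sim X$ that is independent from $X$. $\mathbb{S}(d)$ is the space of real symmetric $d\times d$ matrices and $\mathbb{S}_+(d)$ is the set of positive semidefinite elements of $\mathbb{S}(d)$. A sublinear function is one that is sub-additive and positively homogeneous. $G$-normal distribution: a $d$-dimensional random vector $X$ is $G$-normal distributed if $aX+b\bar X\sim\sqrt{a^2+b^2}\,X$ for all $a,b\ge0$, where $\bar X$ is an independent copy of $X$. The associated function is $G(A)=\hat{E}[\frac12\langle AX,X\rangle]$, $A\in\mathbb{S}(d)$; it determines the law of $X$. There is a bounded, convex, closed set $\Theta\subset\mathbb{S}_+(d)$ with $G(A)=\frac12\sup_{Q\in\Theta}\mathrm{tr}[AQ]$, and one writes $X\sim N(0;\Theta)$. Thus, for a given $G$, $X\sim N(0;\Theta)$ means that $X$ is $G$-normal distributed with $\hat{E}[\frac12\langle AX,X\rangle]=G(A)=\frac12\sup_{Q\in\Theta}\mathrm{tr}[AQ]$. The vector $X$ may live on another sublinear expectation space, whose expectation is still denoted $\hat{E}$. Equivalently, $u(t,x)=\hat{E}[\varphi(x+\sqrt t X)]$ is the unique viscosity solution on $[0,\infty)\times\mathbb{R}^d$ of $\partial_tu-G(D^2u)=0$, $u|_{t=0}=\varphi$, for $\varphi\in C_{b,Lip}(\mathbb{R}^d)$. *)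

(* Defs.v *)
From HB Require Import structures.
From mathcomp Require Import all_boot all_order all_algebra.
From mathcomp Require Import all_classical all_reals all_analysis.

Set Implicit Arguments.
Unset Strict Implicit.
Unset Printing Implicit Defensive.

Import Order.TTheory GRing.Theory Num.Theory.
Import numFieldTopology.Exports numFieldNormedType.Exports.

Local Open Scope classical_set_scope.
Local Open Scope ring_scope.

(* Vectors of R^n are row vectors. The library norm on 'rV[R]_n is the sup
   norm, so the Euclidean inner product and norm are introduced here. *)
Definition dotv (R : realType) (n : nat) (x y : 'rV[R]_n) : R :=
  \sum_(i < n) x 0 i * y 0 i.

Definition enorm (R : realType) (n : nat) (x : 'rV[R]_n) : R :=
  Num.sqrt (dotv x x).

(* <A x, x>; the row vector representing A x is x *m A^T. *)
Definition quadf (R : realType) (n : nat) (A : 'M[R]_n) (x : 'rV[R]_n) : R :=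
  dotv (x *m A^T) x.

Definition ClLip (R : realType) (n : nat) : set ('rV[R]_n -> R) :=
  [set phi | exists (C : R) (m : nat), 0 < C /\ forall x y,
     `|phi x - phi y| <= C * (1 + enorm x ^+ m + enorm y ^+ m) * enorm (x - y)].

Definition CbLip (R : realType) (n : nat) : set ('rV[R]_n -> R) :=
  [set phi | (exists B : R, forall x, `|phi x| <= B) /\
             (exists L : R, forall x y, `|phi x - phi y| <= L * enorm (x - y))].

(* The sublinear expectation is a total function on [Omega -> R], but it is
   constrained only on the space [rvs] of random variables. *)
Record sublinear_space (R : realType) := SublinearSpace {
  Omega :> Type;
  rvs : set (Omega -> R);
  expect : (Omega -> R) -> R;
  rvs_cst : forall c : R, rvs (fun=> c);
  rvs_add : forall X Y, rvs X -> rvs Y -> rvs (fun w => X w + Y w);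
  rvs_scale : forall (c : R) X, rvs X -> rvs (fun w => c * X w);
  rvs_abs : forall X, rvs X -> rvs (fun w => `|X w|);
  rvs_comp : forall (n : nat) (X : Omega -> 'rV[R]_n) (phi : 'rV[R]_n -> R),
    (forall j, rvs (fun w => X w 0 j)) -> ClLip phi ->
    rvs (fun w => phi (X w));
  expect_mono : forall X Y, rvs X -> rvs Y ->
    (forall w, Y w <= X w) -> expect Y <= expect X;
  expect_cst : forall c : R, expect (fun=> c) = c;
  expect_subadd : forall X Y, rvs X -> rvs Y ->
    expect (fun w => X w + Y w) <= expect X + expect Y;
  expect_poshom : forall (c : R) X, rvs X -> 0 <= c ->
    expect (fun w => c * X w) = c * expect X
}.

Definition random_vector (R : realType) (S : sublinear_space R) (n : nat)
    (X : S -> 'rV[R]_n) : Prop :=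
  forall j, rvs (fun w => X w 0 j).

Definition independent_from (R : realType) (S : sublinear_space R) (n m : nat)
    (Y : S -> 'rV[R]_n) (X : S -> 'rV[R]_m) : Prop :=
  forall phi : 'rV[R]_(m + n) -> R, ClLip phi ->
    expect (fun w => phi (row_mx (X w) (Y w))) =
    expect (fun w => expect (fun w' => phi (row_mx (X w) (Y w')))).

Definition same_law (R : realType) (S1 S2 : sublinear_space R) (n : nat)
    (X1 : S1 -> 'rV[R]_n) (X2 : S2 -> 'rV[R]_n) : Prop :=
  forall phi : 'rV[R]_n -> R, CbLip phi ->
    expect (fun w => phi (X1 w)) = expect (fun w => phi (X2 w)).

Definition independent_copy (R : realType) (S : sublinear_space R) (n : nat)
    (Xbar X : S -> 'rV[R]_n) : Prop :=
  [/\ random_vector Xbar, same_law Xbar X & independent_from Xbar X].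

(* The first i + 1 vectors (X_0, ..., X_i), concatenated into one vector of
   R^((i + 1) d). *)
Definition initial_vectors (R : realType) (S : sublinear_space R) (d : nat)
    (X : nat -> S -> 'rV[R]_d) (i : nat) (w : S) : 'rV[R]_(i.+1 * d) :=
  mxvec (\matrix_(k < i.+1, j < d) X k w 0 j).

Definition symmx (R : realType) (d : nat) : set 'M[R]_d := [set A | A^T = A].

Definition psdmx (R : realType) (d : nat) : set 'M[R]_d :=
  [set A | symmx A /\ forall x, 0 <= quadf A x].

Definition sublinear_on_symmx (R : realType) (d : nat) (G : 'M[R]_d -> R)
    : Prop :=
  (forall A B, symmx A -> symmx B -> G (A + B) <= G A + G B) /\
  (forall (c : R) A, symmx A -> 0 <= c -> G (c *: A) = c * G A).

Definition Gfun (R : realType) (S : sublinear_space R) (d : nat)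
    (X : S -> 'rV[R]_d) (A : 'M[R]_d) : R :=
  2^-1 * expect (fun w => quadf A (X w)).

(* The independence of the copy only makes sense on a common space, so the
   copy lives on the space of X. *)
Definition G_normal (R : realType) (S : sublinear_space R) (d : nat)
    (X : S -> 'rV[R]_d) : Prop :=
  random_vector X /\
  exists Xbar : S -> 'rV[R]_d, independent_copy Xbar X /\
    forall a b : R, 0 <= a -> 0 <= b ->
      same_law (fun w => a *: X w + b *: Xbar w)
               (fun w => Num.sqrt (a ^+ 2 + b ^+ 2) *: X w).

(* [Theta] is a bounded, convex, closed set of positive semidefinite matrices
   with G(A) = 1/2 sup_{Q in Theta} tr(A Q). It is nonempty (and bounded), so
   that the library's [sup] is the least upper bound. *)
Definition represents (R : realType) (d : nat) (Theta : set 'M[R]_d)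
    (G : 'M[R]_d -> R) : Prop :=
  [/\ Theta !=set0, Theta `<=` @psdmx R d,
      bounded_set Theta, convex_set Theta & closed Theta] /\
  forall A, symmx A -> G A = 2^-1 * sup [set \tr (A *m Q) | Q in Theta].

(* X ~ N(0; Theta) with associated function G:
   E[1/2 <A X, X>] = G(A) = 1/2 sup_{Q in Theta} tr(A Q). *)
Definition normal_law (R : realType) (S : sublinear_space R) (d : nat)
    (X : S -> 'rV[R]_d) (G : 'M[R]_d -> R) (Theta : set 'M[R]_d) : Prop :=
  [/\ G_normal X, forall A, symmx A -> Gfun X A = G A & represents Theta G].

(* Main.v *)
(* The regularity theory of the G-heat equation is avoided. Put
   T_i f (x) = E[f(x + X_i / sqrt n)] and P f (x) = E[f(x + Z / sqrt n)]; then
   E[phi(S_n / sqrt n)] = T_1 ... T_n phi (0) by independence, and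
   E[phi(Z)] = P^n phi (0) because Z is G-normal. Both T_i and P are monotone,
   sublinear and translation invariant, so each satisfies U(A f) <= A(U f) for
   every finite average A of translations. If A is a fine enough iterated
   average over boxes of side eps, then A f has a second-order Taylor expansion
   with a remainder O(|y|^3), uniformly over the L-Lipschitz functions f, up to
   an arbitrarily small error; hence T_i(A f) and P(A f) differ by
   |G_i - G| / n + O(n^(-3/2)). Starting from A phi and moving A outside at
   each step gives T_1 ... T_n (A phi) <= A (P^n phi) + o(1), and the roles of
   T_i and P can be exchanged: both inequalities of the limit follow without
   any smoothness of P^k phi. *)

Require Import Defs.
From HB Require Import structures.
From mathcomp Require Import all_boot all_order all_algebra.
From mathcomp Require Import all_classical all_reals all_analysis.
From mathcomp Require Import ring lra.

Set Implicit Arguments.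
Unset Strict Implicit.
Unset Printing Implicit Defensive.

Import Order.TTheory GRing.Theory Num.Theory.
Import numFieldTopology.Exports numFieldNormedType.Exports.

Local Open Scope classical_set_scope.
Local Open Scope ring_scope.

(** * Lipschitz functions for the l1 norm *)

Definition l1norm (R : realType) (d : nat) (y : 'rV[R]_d) : R :=
  \sum_(j < d) `|y 0 j|.

(** Lipschitz constants refer to the l1 norm because increments made one coordinate at a time add up
    exactly in it; passing to [enorm] costs at most a factor [d]. *)
Definition lip (R : realType) (d : nat) (L : R) (f : 'rV[R]_d -> R) : Prop :=
  forall x y, `|f x - f y| <= L * l1norm (x - y).

Section L1norm.
Context (R : realType) (d : nat).
Implicit Types (x y : 'rV[R]_d).

Lemma l1norm_ge0 y : 0 <= l1norm y.
Proof. by apply: sumr_ge0 => j _; exact: normr_ge0. Qed.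

Lemma l1normN y : l1norm (- y) = l1norm y.
Proof. by apply: eq_bigr => j _; rewrite mxE normrN. Qed.

Lemma l1normB x y : l1norm (x - y) = l1norm (y - x).
Proof. by rewrite -l1normN opprB. Qed.

Lemma l1normD x y : l1norm (x + y) <= l1norm x + l1norm y.
Proof.
rewrite /l1norm -big_split /=; apply: ler_sum => j _.
by rewrite mxE; exact: ler_normD.
Qed.

Lemma l1normZ c y : l1norm (c *: y) = `|c| * l1norm y.
Proof. by rewrite /l1norm mulr_sumr; apply: eq_bigr => j _; rewrite mxE normrM. Qed.

Lemma l1norm_delta j : l1norm (delta_mx 0 j : 'rV[R]_d) = 1.
Proof.
rewrite /l1norm (bigD1 j) //= big1 ?addr0; first by rewrite mxE !eqxx normr1.
by move=> i ij; rewrite mxE eqxx (negbTE ij) normr0.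
Qed.

Lemma l1norm_coord y j : `|y 0 j| <= l1norm y.
Proof. by rewrite /l1norm (bigD1 j) //= lerDl; apply: sumr_ge0. Qed.

Lemma lip_step (L c : R) (f : 'rV[R]_d -> R) x j : lip L f ->
  `|f (x + c *: delta_mx 0 j) - f x| <= L * `|c|.
Proof.
move=> /(_ (x + c *: delta_mx 0 j) x) /le_trans; apply.
by rewrite [x + _ - x]addrC addKr l1normZ l1norm_delta mulr1.
Qed.

End L1norm.

(** * Averages over finite lists of translations *)

Definition avg (R : realType) (d : nat) (l : seq 'rV[R]_d) (f : 'rV[R]_d -> R)
    (x : 'rV[R]_d) : R :=
  (size l)%:R^-1 * \sum_(a <- l) f (x + a).

Section Average.
Context (R : realType) (d : nat).
Implicit Types (f g : 'rV[R]_d -> R) (l : seq 'rV[R]_d) (x y : 'rV[R]_d).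

Lemma avg_cst l (c : R) : (0 < size l)%N ->
  (size l)%:R^-1 * \sum_(a <- l) c = c.
Proof.
move=> l0; rewrite big_const_seq count_predT iter_addr_0 -[c *+ _]mulr_natl mulrA mulVf ?mul1r//.
by rewrite pnatr_eq0 -lt0n.
Qed.

Lemma avg_near l f (b c : R) x : (0 < size l)%N ->
  (forall a, a \in l -> `|f (x + a) - c| <= b) -> `|avg l f x - c| <= b.
Proof.
move=> l0 fb; rewrite -[X in _ - X](avg_cst c l0) /avg -mulrBr -sumrB.
rewrite normrM ger0_norm ?invr_ge0// -[leRHS](avg_cst b l0) ler_wpM2l ?invr_ge0//.
apply: le_trans (ler_norm_sum _ _ _) _.
by rewrite big_seq [leRHS]big_seq; apply: ler_sum.
Qed.

Lemma avgB l f x y : avg l f x - avg l f y = avg l (fun z => f (z + x - y) - f z) y.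
Proof.
rewrite /avg -mulrBr -sumrB; congr (_ * _); apply: eq_bigr => a _.
by congr (f _ - _); rewrite addrAC [y + a]addrC addrK addrC.
Qed.

Lemma lip_avg l L f : (0 < size l)%N -> lip L f -> lip L (avg l f).
Proof.
move=> l0 fL x y; rewrite avgB -[avg _ _ _]subr0; apply: avg_near => // a _.
by rewrite subr0; apply: le_trans (fL _ _) _; rewrite -[y + a + x - y]addrA [y + a + _]addrC addrK.
Qed.

(** The sums a + b are listed with multiplicity, so an iterated average is again an [avg]. *)
Lemma avg_comp l1 l2 f x :
  avg [seq a + b | a <- l1, b <- l2] f x = avg l1 (avg l2 f) x.
Proof.
rewrite /avg size_allpairs natrM invfM big_allpairs_dep /= -mulrA; congr (_ * _).
rewrite mulr_sumr; apply: eq_bigr => a _; congr (_ * _).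
by apply: eq_bigr => b _; rewrite addrA.
Qed.

Lemma avg_comm l1 l2 f x : avg l1 (avg l2 f) x = avg l2 (avg l1 f) x.
Proof.
rewrite /avg -!mulr_sumr !mulrA; congr (_ * _); first by rewrite mulrC.
rewrite exchange_big; apply: eq_bigr => a _; apply: eq_bigr => b _.
by rewrite addrAC.
Qed.

Lemma avg_close l L f (r : R) x : (0 < size l)%N -> 0 <= L -> lip L f ->
  (forall a, a \in l -> l1norm a <= r) -> `|avg l f x - f x| <= L * r.
Proof.
move=> l0 L0 fL lr; apply: avg_near => // a al.
by apply: le_trans (fL _ _) _; rewrite ler_wpM2l// [x + a - x]addrC addKr lr.
Qed.

End Average.

(** * Box averages in one direction and their first-order expansion *)

(** Shifting the window of length [N] from [m] to [m + 1] adds F (N + m) - F m, which is F N - F 0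
    up to [b * m]; these errors add up to at most b m^2. *)
Lemma window_sum (R : realType) (F : nat -> R) (N : nat) (b : R) : 0 <= b ->
    (forall k, `|F (N + k)%N - F k - (F N - F 0)| <= b * k%:R) ->
  forall m, `|\sum_(k < N) F (m + k)%N - \sum_(k < N) F k - m%:R * (F N - F 0)|
            <= b * m%:R ^+ 2.
Proof.
move=> b0 HF; elim=> [|m IH].
  by rewrite subrr mul0r subr0 normr0 expr0n mulr0.
have -> : \sum_(k < N) F (m.+1 + k)%N =
    \sum_(k < N) F (m + k)%N + (F (N + m)%N - F m).
  have : \sum_(k < N.+1) F (m + k)%N = \sum_(k < N.+1) F (m + k)%N by [].
  rewrite {1}big_ord_recl big_ord_recr /= addn0 [(N + m)%N]addnC.
  under eq_bigr do rewrite /bump add1n addnS -addSn.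
  move=> E; lra.
set s1 := \sum_(_ < _) _ in IH *; set s0 := \sum_(_ < _) _ in IH *.
rewrite (_ : _ - _ = (s1 - s0 - m%:R * (F N - F 0)) +
                     (F (N + m)%N - F m - (F N - F 0))); last first.
  by rewrite -natr1; ring.
apply: le_trans (ler_normD _ _) _; apply: le_trans (lerD IH (HF m)) _.
rewrite -mulrDr ler_wpM2l// -natr1 sqrrD mulr1 expr1n.
have : 0 <= m%:R :> R by []; lra.
Qed.

Section Box.
Context (R : realType) (d : nat) (eps : R) (N : nat).
Hypotheses (eps0 : 0 < eps) (N0 : (0 < N)%N).
Implicit Types (f : 'rV[R]_d -> R) (j : 'I_d).

(** A discrete segment instead of an integral: the average stays a finite sum, to which
    subadditivity of the expectation applies. *)
Definition box j : seq 'rV[R]_d :=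
  [seq (k%:R * (eps / N%:R)) *: delta_mx 0 j | k <- iota 0 N].

(** For continuous [f] this is the exact derivative, in direction [j], of the mean of [f] over the
    segment from x to x + eps e_j. *)
Definition dquot j f (x : 'rV[R]_d) : R := (f (x + eps *: delta_mx 0 j) - f x) / eps.

Let NR0 : 0 < N%:R :> R. Proof. by rewrite ltr0n. Qed.

Lemma size_box j : size (box j) = N.
Proof. by rewrite size_map size_iota. Qed.

Lemma box_l1norm j a : a \in box j -> l1norm a <= eps.
Proof.
move=> /mapP[k]; rewrite mem_iota add0n => /andP[_ kN] ->.
rewrite l1normZ l1norm_delta mulr1 ger0_norm; last first.
  by rewrite mulr_ge0 ?divr_ge0// ltW.
by rewrite mulrCA ler_piMr ?(ltW eps0)// ler_pdivrMr ?mul1r ?ler_nat 1?ltnW.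
Qed.

Lemma dquot_bound j f L x : 0 <= L -> lip L f -> `|dquot j f x| <= L.
Proof.
move=> L0 fL; rewrite normrM normfV (gtr0_norm eps0) ler_pdivrMr//.
by apply: le_trans (lip_step _ _ _ fL) _; rewrite gtr0_norm.
Qed.

Lemma lip_dquot j f L : lip L f -> lip (2 * L / eps) (dquot j f).
Proof.
move=> fL x y; rewrite /dquot -mulrBl normrM normfV (gtr0_norm eps0).
rewrite mulrAC ler_pM2r ?invr_gt0//.
set u := eps *: _.
have := fL x y; have := fL (x + u) (y + u).
rewrite [x + u - _]addrC opprD -addrA [- u + _]addrC -!addrA subrr addr0 [- y + x]addrC.
rewrite !ler_norml; lra.
Qed.

Lemma box_sum j f x (c : R) :
  avg (box j) f (x + c *: delta_mx 0 j) =
  N%:R^-1 * \sum_(k < N) f (x + (c + k%:R * (eps / N%:R)) *: delta_mx 0 j).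
Proof.
rewrite /avg size_box big_map.
rewrite -(big_mkord xpredT (fun k => f (x + (c + k%:R * (eps / N%:R)) *: _))).
rewrite /index_iota subn0; congr (_ * _).
by apply: eq_bigr => k _; rewrite scalerDl addrA.
Qed.

(** Round [s] down to [m] whole grid steps. For these the average is a sliding window, handled by
    [window_sum] ([H1]); the leftover, shorter than one step, changes the average and the linear
    term by at most L eps / N each ([H2], [H3]). *)
Lemma box_taylor1_ge0 j f L x (s : R) : 0 <= L -> lip L f -> 0 <= s ->
  `|avg (box j) f (x + s *: delta_mx 0 j) - avg (box j) f x - s * dquot j f x|
  <= 2 * L / eps * s ^+ 2 + 2 * L * (eps / N%:R).
Proof.
move=> L0 fL s0.
set e := eps / N%:R; have e0 : 0 < e by rewrite divr_gt0.
have Ne : N%:R * e = eps by rewrite mulrC divfK// gt_eqF.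
pose m := Num.truncn (s / e).
have se0 : 0 <= s / e by rewrite divr_ge0// ltW.
have /andP[ms sm] := truncn_itv se0.
rewrite -/m in ms sm.
have {}ms : m%:R * e <= s by rewrite -ler_pdivlMr.
have {}sm : s - m%:R * e < e.
  by rewrite ltrBlDl; move: sm; rewrite ltr_pdivrMr// -natr1 mulrDl mul1r.
pose F k := f (x + (k%:R * e) *: delta_mx 0 j).
(* Both F (N + k) - F N and F k - F 0 are increments of a Lipschitz function over [k] grid steps. *)
have HF k : `|F (N + k)%N - F k - (F N - F 0)| <= 2 * L * e * k%:R.
  have : `|F (N + k)%N - F N| <= L * (e * k%:R).
    rewrite /F natrD mulrDl scalerDl addrA.
    apply: le_trans (lip_step _ _ _ fL) _.
    by rewrite ger0_norm ?[k%:R * _]mulrC// mulr_ge0// ltW.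
  have : `|F k - F 0| <= L * (e * k%:R).
    rewrite /F mul0r scale0r addr0.
    apply: le_trans (lip_step _ _ _ fL) _.
    by rewrite ger0_norm ?[k%:R * _]mulrC// mulr_ge0// ltW.
  rewrite !ler_norml; lra.
have b0 : 0 <= 2 * L * e by rewrite !mulr_ge0// ltW.
have HA := window_sum b0 HF m.
have A1 : avg (box j) f (x + (m%:R * e) *: delta_mx 0 j) =
    N%:R^-1 * \sum_(k < N) F (m + k)%N.
  rewrite box_sum; congr (_ * _); apply: eq_bigr => k _.
  by rewrite /F natrD mulrDl.
have A0 : avg (box j) f x = N%:R^-1 * \sum_(k < N) F k.
  rewrite -[x in LHS]addr0 -(scale0r (delta_mx 0 j)) box_sum; congr (_ * _).
  by apply: eq_bigr => k _; rewrite /F add0r.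
have DF : F N - F 0 = N%:R * e * dquot j f x.
  by rewrite Ne /dquot /F Ne mul0r scale0r addr0 mulrC divfK// gt_eqF.
have H1 : `|avg (box j) f (x + (m%:R * e) *: delta_mx 0 j) - avg (box j) f x
           - m%:R * e * dquot j f x| <= 2 * L / eps * s ^+ 2.
  rewrite A1 A0 -mulrBr.
  have -> : m%:R * e * dquot j f x = N%:R^-1 * (m%:R * (F N - F 0)).
    by rewrite DF; field; rewrite gt_eqF.
  rewrite -mulrBr normrM ger0_norm ?invr_ge0 ?(ltW NR0)//.
  apply: (@le_trans _ _ (N%:R^-1 * (2 * L * e * m%:R ^+ 2))).
    by rewrite ler_wpM2l// invr_ge0 ltW.
  have -> : N%:R^-1 * (2 * L * e * m%:R ^+ 2) = 2 * L / eps * (m%:R * e) ^+ 2.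
    by rewrite /e; field; rewrite !gt_eqF.
  have q0 : 0 <= 2 * L / eps by rewrite divr_ge0 ?mulr_ge0 ?(ltW eps0).
  rewrite ler_wpM2l//.
  by rewrite ler_pXn2r// nnegrE// mulr_ge0// ltW.
have H2 : `|avg (box j) f (x + s *: delta_mx 0 j)
           - avg (box j) f (x + (m%:R * e) *: delta_mx 0 j)| <= L * e.
  rewrite -[s](subrK (m%:R * e)) [_ - _ + _]addrC scalerDl addrA.
  have aL : lip L (avg (box j) f) by apply: lip_avg; rewrite ?size_box.
  apply: le_trans (lip_step _ _ _ aL) _.
  by rewrite ler_wpM2l// ger0_norm ?subr_ge0// ltW.
have H3 : `|(s - m%:R * e) * dquot j f x| <= L * e.
  rewrite normrM mulrC ler_pM//; first exact: dquot_bound.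
  by rewrite ger0_norm ?subr_ge0// ltW.
move: H1 H2 H3; rewrite !ler_norml -/e; lra.
Qed.

(** For negative [s], expand at the other endpoint with step [- s]; moving the difference quotient
    back to [x] doubles the quadratic error. *)
Lemma box_taylor1 j f L x (s : R) : 0 <= L -> lip L f ->
  `|avg (box j) f (x + s *: delta_mx 0 j) - avg (box j) f x - s * dquot j f x|
  <= 4 * L / eps * s ^+ 2 + 2 * L * (eps / N%:R).
Proof.
move=> L0 fL.
have pos : 0 <= 2 * L / eps * s ^+ 2 by rewrite mulr_ge0 ?sqr_ge0// divr_ge0 ?mulr_ge0 ?(ltW eps0).
case: (leP 0 s) => s0.
  by apply: le_trans (box_taylor1_ge0 _ _ L0 fL s0) _; lra.
have Ns0 : 0 <= - s by rewrite oppr_ge0 ltW.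
have := box_taylor1_ge0 j (x + s *: delta_mx 0 j) L0 fL Ns0.
rewrite sqrrN scaleNr addrK.
have : `|s * (dquot j f (x + s *: delta_mx 0 j) - dquot j f x)|
    <= 2 * L / eps * s ^+ 2.
  rewrite normrM -[s ^+ 2]real_normK ?num_real// expr2 mulrCA ler_wpM2l//.
  by apply: lip_step; exact: lip_dquot.
move: pos; rewrite !ler_norml; lra.
Qed.

End Box.

(** * From one-dimensional expansions to a second-order expansion *)

Section Taylor.
Context (R : realType) (d : nat).
Implicit Types (f : 'rV[R]_d -> R) (x y : 'rV[R]_d).

(** Move one coordinate at a time. Each partial derivative is then taken at a displaced point, which
    costs [K] times a product of increments; these products and the squares fit into the square of
    the l1 norm. *)
Lemma coordinatewise_taylor1 f (g : 'I_d -> 'rV[R]_d -> R) (K kappa : R) : 0 <= K ->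
    (forall j x s, `|f (x + s *: delta_mx 0 j) - f x - s * g j x| <= K * s ^+ 2 + kappa) ->
    (forall j, lip K (g j)) ->
  forall x y, `|f (x + y) - f x - \sum_j y 0 j * g j x|
              <= K * l1norm y ^+ 2 + d%:R * kappa.
Proof.
move=> K0 f1 gK x y.
have -> : d%:R * kappa = \sum_(j < d) kappa.
  by rewrite sumr_const card_ord -[RHS]mulr_natl.
rewrite [in f (x + y)](row_sum_delta y) /l1norm.
(* The induction is over an arbitrary list of coordinates already moved. *)
elim: (index_enum _) => [|j s IH].
  by rewrite !big_nil addr0 subrr subr0 normr0 expr0n mulr0 addr0.
rewrite !big_cons.
set Y := \sum_(i <- s) _ in IH *; set n := \sum_(i <- s) `|_| in IH *.
set q := \sum_(i <- s) _ * _ in IH *; set k := \sum_(i <- s) kappa in IH *.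
have Yn : l1norm Y <= n.
  rewrite /Y /n; elim: (s) => [|i t IHt].
    by rewrite !big_nil /l1norm big1// => i _; rewrite mxE normr0.
  rewrite !big_cons; apply: le_trans (l1normD _ _) _; apply: lerD => //.
  by rewrite l1normZ l1norm_delta mulr1.
have n0 : 0 <= n by apply: sumr_ge0.
have H1 : `|y 0 j * (g j (x + Y) - g j x)| <= K * (`|y 0 j| * n).
  rewrite normrM mulrCA ler_wpM2l//; apply: le_trans (gK _ _ _) _.
  by rewrite ler_wpM2l// [x + Y - x]addrC addKr.
have H2 := f1 j (x + Y) (y 0 j).
rewrite (_ : x + _ = x + Y + y 0 j *: delta_mx 0 j); last first.
  by rewrite [_ + Y]addrC addrA.
have H3 : 0 <= K * (`|y 0 j| * n) by rewrite !mulr_ge0.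
have -> : K * (`|y 0 j| + n) ^+ 2 =
    K * `|y 0 j| ^+ 2 + 2 * (K * (`|y 0 j| * n)) + K * n ^+ 2 by ring.
rewrite real_normK ?num_real//.
move: H1 H2 IH; rewrite !ler_norml; lra.
Qed.

(* The segment from [x] to [x + y] is cut into [m] pieces: the first-order
   expansion of [f] on each piece combines with that of its gradient. *)
Lemma taylor2 f (g : 'I_d -> 'rV[R]_d -> R) (h : 'I_d -> 'I_d -> R)
    (K kappa : R) x (m : nat) : 0 <= K -> 0 <= kappa -> (0 < m)%N ->
    (forall x y, `|f (x + y) - f x - \sum_j y 0 j * g j x|
                 <= K * l1norm y ^+ 2 + kappa) ->
    (forall j y, `|g j (x + y) - g j x - \sum_i y 0 i * h j i|
                   <= K * l1norm y ^+ 2 + kappa) ->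
    (forall i j, `|h i j| <= K) ->
  forall y, `|f (x + y) - f x - \sum_j y 0 j * g j x
              - 2^-1 * \sum_i \sum_j h i j * (y 0 i * y 0 j)|
    <= K * l1norm y ^+ 3 + 2 * K * l1norm y ^+ 2 / m%:R
       + m%:R * kappa + l1norm y * kappa.
Proof.
move=> K0 k0 m0 f1 g1 hK y.
have mR : 0 < m%:R :> R by rewrite ltr0n.
have mN : m%:R != 0 :> R by rewrite gt_eqF.
set n := l1norm y; have n0 : 0 <= n := l1norm_ge0 y.
set a := \sum_j y 0 j * g j x; set q := \sum_i _.
have qn : `|q| <= K * n ^+ 2.
  apply: le_trans (ler_norm_sum _ _ _) _.
  apply: (@le_trans _ _ (\sum_i \sum_j K * (`|y 0 i| * `|y 0 j|))).
    apply: ler_sum => i _; apply: le_trans (ler_norm_sum _ _ _) _.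
    by apply: ler_sum => j _; rewrite !normrM ler_wpM2r// mulr_ge0.
  rewrite expr2 {1}/n /l1norm mulr_suml mulr_sumr; apply: ler_sum => i _.
  by rewrite -!mulr_sumr.
pose z (k : nat) : 'rV[R]_d := (k%:R / m%:R) *: y.
pose B := K * n ^+ 2 / m%:R ^+ 2 + kappa + n / m%:R * (K * n ^+ 2 + kappa).
(* The gradient at the i-th division point contributes i q / m^2, and the sum over i < k is k (k -
   1) q / (2 m^2). At k = m this misses q / 2 by q / (2 m), which is absorbed in the term with
   [2 * K]. *)
have claim k : (k <= m)%N ->
    `|f (x + z k) - f x - k%:R / m%:R * a
      - 2^-1 * (k%:R * (k%:R - 1) / m%:R ^+ 2) * q| <= k%:R * B.
  elim: k => [_|k IH km].
    by rewrite /z !mul0r scale0r addr0 mulr0 mul0r !subr0 subrr normr0.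
  have {}IH := IH (ltnW km).
  pose w : 'rV[R]_d := m%:R^-1 *: y.
  have -> : x + z k.+1 = x + z k + w.
    by rewrite /z /w -addrA -scalerDl -natr1 mulrDl mul1r.
  have H1 : `|f (x + z k + w) - f (x + z k) - m%:R^-1 * \sum_j y 0 j * g j (x + z k)|
       <= K * n ^+ 2 / m%:R ^+ 2 + kappa.
    have -> : m%:R^-1 * \sum_j y 0 j * g j (x + z k) = \sum_j w 0 j * g j (x + z k).
      by rewrite mulr_sumr; apply: eq_bigr => j _; rewrite mxE mulrA.
    apply: le_trans (f1 (x + z k) w) _.
    by rewrite l1normZ normfV (ger0_norm (ltW mR)) exprMn exprVn mulrCA mulrC.
  have km1 : 0 <= k%:R / m%:R :> R by rewrite divr_ge0.
  have km2 : k%:R / m%:R <= 1 :> R by rewrite ler_pdivrMr// mul1r ler_nat ltnW.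
  have H2 : `|\sum_j y 0 j * g j (x + z k) - a - k%:R / m%:R * q|
       <= n * (K * n ^+ 2 + kappa).
    rewrite /a /q [_ * \sum_i _]mulr_sumr -!sumrB.
    apply: le_trans (ler_norm_sum _ _ _) _.
    rewrite {1}/n /l1norm mulr_suml; apply: ler_sum => j _.
    have -> : y 0 j * g j (x + z k) - y 0 j * g j x -
        k%:R / m%:R * (\sum_i h j i * (y 0 j * y 0 i)) =
        y 0 j * (g j (x + z k) - g j x - \sum_i z k 0 i * h j i).
      rewrite !mulrBr; congr (_ - _); rewrite !mulr_sumr; apply: eq_bigr => i _.
      by rewrite mxE; ring.
    rewrite normrM ler_wpM2l//; apply: le_trans (g1 _ _) _.
    rewrite lerD2r ler_wpM2l// l1normZ ger0_norm//.
    by rewrite ler_pXn2r ?nnegrE ?mulr_ge0// -/n ler_piMl.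
  have H3 : `|m%:R^-1 * (\sum_j y 0 j * g j (x + z k) - a - k%:R / m%:R * q)|
       <= n / m%:R * (K * n ^+ 2 + kappa).
    by rewrite normrM normfV (ger0_norm (ltW mR)) [leRHS]mulrAC [leLHS]mulrC ler_pM2r ?invr_gt0.
  have -> : f (x + z k + w) - f x - k.+1%:R / m%:R * a
      - 2^-1 * (k.+1%:R * (k.+1%:R - 1) / m%:R ^+ 2) * q =
    (f (x + z k + w) - f (x + z k) - m%:R^-1 * \sum_j y 0 j * g j (x + z k)) +
    m%:R^-1 * (\sum_j y 0 j * g j (x + z k) - a - k%:R / m%:R * q) +
    (f (x + z k) - f x - k%:R / m%:R * a
      - 2^-1 * (k%:R * (k%:R - 1) / m%:R ^+ 2) * q).
    by rewrite -natr1; field.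
  rewrite -(natr1 k) mulrDl mul1r {2}/B [leRHS]addrC.
  apply: le_trans (ler_normD _ _) _; apply: lerD => //.
  by apply: le_trans (ler_normD _ _) _; apply: lerD.
have := claim m (leqnn m); rewrite /z divff// scale1r mul1r.
have -> : 2^-1 * (m%:R * (m%:R - 1) / m%:R ^+ 2) * q = 2^-1 * q - 2^-1 * (q / m%:R).
  by field.
have -> : m%:R * B = K * n ^+ 2 / m%:R + m%:R * kappa + K * n ^+ 3 + n * kappa.
  by rewrite /B; field.
have H : `|q / m%:R| <= K * n ^+ 2 / m%:R.
  by rewrite normrM normfV (ger0_norm (ltW mR)) ler_pM2r ?invr_gt0.
rewrite -[2 * K * _]mulrA -[2 * _ / _]mulrA.
move: H; rewrite !ler_norml; lra.
Qed.

Lemma quadfE (A : 'M[R]_d) y :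
  quadf A y = \sum_i \sum_j A i j * (y 0 i * y 0 j).
Proof.
apply: eq_bigr => i _; rewrite mxE mulr_suml; apply: eq_bigr => j _.
by rewrite mxE; ring.
Qed.

End Taylor.

(** * Smoothing Lipschitz functions by averaging over boxes *)

Section Smoothing.
Context (R : realType) (d : nat).
Implicit Types (f : 'rV[R]_d -> R) (x y : 'rV[R]_d).

(** Compose one box average per direction. Since averages commute, the box of any given direction
    can be brought outermost, where its one-dimensional expansion applies. *)
Lemma avg_box_product (eps : R) (N : nat) (s : seq 'I_d) : 0 < eps -> (0 < N)%N ->
  exists l : seq 'rV[R]_d, [/\ (0 < size l)%N,
    forall a, a \in l -> l1norm a <= (size s)%:R * eps &
    forall j, j \in s -> exists l' : seq 'rV[R]_d,
      (0 < size l')%N /\ forall f, avg l f = avg (box eps N j) (avg l' f)].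
Proof.
move=> e0 N0; elim: s => [|i s [l [l0 lr lb]]].
  exists [:: 0]; split => // a; rewrite inE => /eqP ->.
  by rewrite mul0r /l1norm big1// => j _; rewrite mxE normr0.
have avgcomp l1 l2 f : avg [seq a + b | a <- l1, b <- l2] f = avg l1 (avg l2 f).
  by apply/funext => x; rewrite avg_comp.
exists [seq a + b | a <- box eps N i, b <- l]; split.
- by rewrite size_allpairs size_box muln_gt0 N0.
- move=> _ /allpairsP[[a b] /= [ai bl ->]]; apply: le_trans (l1normD _ _) _.
  rewrite -natr1 mulrDl mul1r addrC; apply: lerD; first exact: lr.
  exact: box_l1norm ai.
move=> j; rewrite inE; have [-> _|_ /= js] := eqVneq j i.
  by exists l; split.
have [l' [l'0 l'b]] := lb _ js.
exists [seq a + b | a <- box eps N i, b <- l']; split.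
  by rewrite size_allpairs size_box muln_gt0 N0.
move=> f; rewrite !avgcomp l'b; apply/funext => x; exact: avg_comm.
Qed.

Lemma dquot_avg (eps : R) j l f x :
  dquot eps j (avg l f) x = avg l (dquot eps j f) x.
Proof.
rewrite /dquot /avg -mulrBr -sumrB -mulrA; congr (_ * _).
by rewrite mulr_suml; apply: eq_bigr => a _; rewrite addrAC.
Qed.

(** One product of box averages gives a first-order expansion with Lipschitz gradient; averaging
    twice allows that expansion for the gradient too, and [taylor2] combines both. The order of
    quantifiers matters: [K] depends on [L] and [eps] only, whereas the grid is refined according to
    [kappa], so [kappa] may later tend to 0 with [K] fixed. *)
Lemma smoothing (L eps : R) : 0 <= L -> 0 < eps ->
  exists2 K : R, 0 <= K & forall kappa, 0 < kappa ->
  exists l : seq 'rV[R]_d, [/\ (0 < size l)%N,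
    forall a, a \in l -> l1norm a <= eps &
    forall f x, lip L f -> exists (p : 'I_d -> R) (H : 'M[R]_d),
      [/\ symmx H, forall i j, `|H i j| <= K &
       forall y, `|avg l f (x + y) - avg l f x - \sum_j y 0 j * p j
                   - 2^-1 * quadf H y|
          <= K * l1norm y ^+ 3 + kappa * (1 + l1norm y ^+ 3)]].
Proof.
move=> L0 eps0.
(* Two products of [d] boxes of side [e] displace a point by at most 2 d e; the summand 1 keeps the
   denominator positive. *)
have [e eE] : {e | e = eps / (2 * d%:R + 1)} by exists (eps / (2 * d%:R + 1)).
have D0 : 0 < 2 * d%:R + 1 :> R.
  by have : 0 <= d%:R :> R by []; lra.
have e0 : 0 < e by rewrite eE divr_gt0.
pose L1 := 2 * L / e; have L10 : 0 <= L1 by rewrite /L1 divr_ge0 ?(ltW e0) ?mulr_ge0.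
pose K := 4 * L / e + 4 * L1 / e + L1.
have q0 : 0 <= 4 * L / e by rewrite divr_ge0 ?(ltW e0) ?mulr_ge0.
have q1 : 0 <= 4 * L1 / e by rewrite divr_ge0 ?(ltW e0)// mulr_ge0.
have K0 : 0 <= K by rewrite /K !addr_ge0.
exists K => // kappa kappa0.
(* [m] is the number of pieces in [taylor2], chosen to make 2 K / m small; [N] is then chosen so
   fine that the grid error [kp] stays small after multiplication by [m * d]. *)
pose m := (Num.truncn (4 * K / kappa)).+1.
have mR : 0 < m%:R :> R by [].
have mK : 2 * K / m%:R <= kappa / 2.
  have : 4 * K / kappa < m%:R.
    by have /andP[] := truncn_itv (divr_ge0 (mulr_ge0 (ler0n R 4) K0) (ltW kappa0)).
  by rewrite ltr_pdivrMr// ler_pdivrMr//; lra.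
pose C := d%:R * (2 * (L + L1) * e) * (4 * m%:R) / kappa.
have C0 : 0 <= C by rewrite /C divr_ge0 ?mulr_ge0 ?addr_ge0 ?(ltW e0) ?(ltW kappa0).
pose N := (Num.truncn C).+1.
have NR : 0 < N%:R :> R by [].
pose kp := 2 * (L + L1) * (e / N%:R).
have kp0 : 0 <= kp by rewrite /kp !mulr_ge0 ?addr_ge0 ?invr_ge0// ltW.
have kpm : m%:R * (d%:R * kp) <= kappa / 4.
  have : C < N%:R by have /andP[] := truncn_itv C0.
  rewrite /C ltr_pdivrMr// => H.
  have -> : m%:R * (d%:R * kp) = d%:R * (2 * (L + L1) * e) * (4 * m%:R) / (4 * N%:R).
    by rewrite /kp; field; rewrite gt_eqF.
  rewrite ler_pdivrMr ?mulr_gt0//; lra.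
have dkp0 : 0 <= d%:R * kp by rewrite mulr_ge0.
have kpd : d%:R * kp <= kappa / 4.
  by apply: le_trans kpm; rewrite ler_peMl// ler1n.
have [P [P0 Pr Pb]] := @avg_box_product e N (enum 'I_d) e0 isT.
have {Pb} /choice[Q PQ] : forall j, exists l' : seq 'rV[R]_d,
    (0 < size l')%N /\ forall f, avg P f = avg (box e N j) (avg l' f).
  by move=> j; apply: Pb; rewrite mem_enum.
have PP f : avg [seq a + b | a <- P, b <- P] f = avg P (avg P f).
  by apply/funext => x; rewrite avg_comp.
exists [seq a + b | a <- P, b <- P]; split.
- by rewrite size_allpairs muln_gt0 P0.
- move=> _ /allpairsP[[a b] /= [aP bP ->]]; apply: le_trans (l1normD _ _) _.
  apply: le_trans (lerD (Pr _ aP) (Pr _ bP)) _.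
  rewrite size_enum_ord eE mulrA -mulrDl ler_pdivrMr//.
  have : 0 <= eps by rewrite ltW.
  have : 0 <= d%:R * eps by rewrite mulr_ge0 ?(ltW eps0).
  lra.
move=> f x fL.
(* Used twice: with [chi] equal to [avg P f] and constant [L], and with [chi] equal to a gradient
   component [g j] and constant [L1]. *)
have T1 chi A : 0 <= A -> A <= L + L1 -> 4 * A / e <= K -> lip A chi ->
    forall x y, `|avg P chi (x + y) - avg P chi x
                  - \sum_j y 0 j * dquot e j (avg (Q j) chi) x|
      <= K * l1norm y ^+ 2 + d%:R * kp.
  move=> A0 AL AK chiA; apply: coordinatewise_taylor1 => // j.
    move=> u s; have [Qj0 ->] := PQ j.
    apply: le_trans (box_taylor1 e0 (isT : 0 < N)%N j u s A0 (lip_avg Qj0 chiA)) _.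
    rewrite lerD ?ler_wpM2r ?sqr_ge0 ?divr_ge0 ?(ltW e0)//.
    by rewrite ler_wpM2l.
  move=> u v; have [Qj0 _] := PQ j.
  apply: le_trans (lip_dquot e0 j (lip_avg Qj0 chiA) u v) _.
  rewrite ler_wpM2r ?l1norm_ge0//; apply: le_trans AK.
  by rewrite ler_pM2r ?invr_gt0//; lra.
pose g j := dquot e j (avg (Q j) f).
have gL j : lip L1 (g j).
  by have [Qj0 _] := PQ j; apply: lip_dquot => //; exact: lip_avg.
have gE j : avg P (g j) = dquot e j (avg (Q j) (avg P f)).
  apply/funext => u; rewrite /g -dquot_avg; congr (dquot e j _ u).
  by apply/funext => v; rewrite avg_comm.
pose h j k := dquot e k (avg (Q k) (g j)) x.
have hK j k : `|h j k| <= K.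
  have [Qk0 _] := PQ k; apply: (@le_trans _ _ L1); last by rewrite /K; lra.
  by apply: dquot_bound => //; exact: lip_avg.
(* [h] is symmetrized; the quadratic form does not change. *)
exists (fun j => avg P (g j) x), (\matrix_(i, j) (2^-1 * (h i j + h j i))).
split.
- by apply/matrixP => i j; rewrite !mxE addrC.
- move=> i j; rewrite mxE; have := hK i j; have := hK j i.
  by rewrite !ler_norml; lra.
move=> y; rewrite PP.
have -> : quadf (\matrix_(i, j) (2^-1 * (h i j + h j i))) y =
    \sum_i \sum_j h i j * (y 0 i * y 0 j).
  rewrite quadfE.
  have -> : \sum_i \sum_j h i j * (y 0 i * y 0 j) =
     2^-1 * (\sum_i \sum_j h i j * (y 0 i * y 0 j)
             + \sum_i \sum_j h j i * (y 0 j * y 0 i)).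
    by rewrite [X in _ + X]exchange_big /=; field.
  rewrite -big_split mulr_sumr; apply: eq_bigr => i _.
  rewrite -big_split mulr_sumr; apply: eq_bigr => j _.
  by rewrite mxE /=; ring.
have K1 : 4 * L / e <= K by rewrite /K; lra.
have K2 : 4 * L1 / e <= K by rewrite /K; lra.
have := @taylor2 R d (avg P (avg P f)) (fun j => avg P (g j)) h K (d%:R * kp) x m.
move=> /(_ K0 dkp0 isT) /(_ _ _ hK y).
set n := l1norm y; have n0 : 0 <= n := l1norm_ge0 y.
set lhs := `|_| ; move=> T.
have {T} : lhs <= K * n ^+ 3 + 2 * K * n ^+ 2 / m%:R + m%:R * (d%:R * kp) + n * (d%:R * kp).
  apply: T.
    move=> u v.
    rewrite (eq_bigr (fun j => v 0 j * dquot e j (avg (Q j) (avg P f)) u)).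
      by apply: (T1 (avg P f) L L0 _ K1 (lip_avg P0 fL)); lra.
    by move=> j _; rewrite gE.
  by move=> j v; apply: (T1 (g j) L1 L10 _ K2 (gL j)); lra.
move/le_trans; apply.
(* Expanded, this says n + n^2 <= 1 + n^3, which bounds both lower powers. *)
have nn : 0 <= (1 - n) ^+ 2 * (1 + n) by rewrite mulr_ge0 ?sqr_ge0 ?addr_ge0.
have nn2 := sqr_ge0 n.
have n2 : n ^+ 2 <= 1 + n ^+ 3 by lra.
have n1 : n <= 1 + n ^+ 3 by lra.
have -> : 2 * K * n ^+ 2 / m%:R = 2 * K / m%:R * n ^+ 2 by ring.
have h1 : 2 * K / m%:R * n ^+ 2 <= kappa / 2 * (1 + n ^+ 3).
  by apply: ler_pM => //; rewrite ?sqr_ge0// divr_ge0 ?mulr_ge0.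
have h2 : n * (d%:R * kp) <= (1 + n ^+ 3) * (kappa / 4) by apply: ler_pM.
have h3 : 0 <= n ^+ 3 by rewrite exprn_ge0.
have h4 : 0 <= kappa * n ^+ 3 by rewrite mulr_ge0// ltW.
lra.
Qed.

End Smoothing.

(** * The Euclidean norm, and the classes [ClLip] and [CbLip] *)

Section EuclideanNorm.
Context (R : realType) (d : nat).
Implicit Types (x y : 'rV[R]_d).

Lemma dotv_ge0 x : 0 <= dotv x x.
Proof. by apply: sumr_ge0 => j _; rewrite -expr2 sqr_ge0. Qed.

Lemma enorm_sqr x : enorm x ^+ 2 = dotv x x.
Proof. by rewrite sqr_sqrtr// dotv_ge0. Qed.

Lemma dotv_combination (a b : R) x y : dotv (a *: x + b *: y) (a *: x + b *: y) =
  a ^+ 2 * dotv x x + 2 * a * b * dotv x y + b ^+ 2 * dotv y y.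
Proof.
rewrite /dotv !mulr_sumr -!big_split; apply: eq_bigr => j _ /=.
by rewrite !mxE; ring.
Qed.

Lemma enorm_coord x j : `|x 0 j| <= enorm x.
Proof.
rewrite -sqrtr_sqr ler_wsqrtr// /dotv (bigD1 j)//= expr2 lerDl.
by apply: sumr_ge0 => i _; rewrite -expr2 sqr_ge0.
Qed.

Lemma enorm_le_l1norm x : enorm x <= l1norm x.
Proof.
rewrite -[leRHS](ger0_norm (l1norm_ge0 x)) -sqrtr_sqr ler_wsqrtr//.
rewrite expr2 {1}/l1norm mulr_suml; apply: ler_sum => j _.
rewrite -expr2 -real_normK ?num_real// expr2 ler_wpM2l//.
exact: l1norm_coord.
Qed.

Lemma l1norm_le_enorm x : l1norm x <= d%:R * enorm x.
Proof.
apply: (@le_trans _ _ (\sum_(j < d) enorm x)).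
  by apply: ler_sum => j _; exact: enorm_coord.
by rewrite sumr_const card_ord -[leLHS]mulr_natl.
Qed.

(** Cauchy-Schwarz: expand the square of |y| x - |x| y and divide by 2 |x| |y|, the case of a zero
    norm being separate. *)
Lemma dotv_le x y : dotv x y <= enorm x * enorm y.
Proof.
have [a0 b0] : 0 <= enorm x /\ 0 <= enorm y by split; exact: sqrtr_ge0.
have zero (u v : 'rV[R]_d) : enorm u = 0 -> dotv u v = 0.
  move=> u0; apply: big1 => j _.
  by have := enorm_coord u j; rewrite u0 normr_le0 => /eqP ->; rewrite mul0r.
have dotC (u v : 'rV[R]_d) : dotv u v = dotv v u by apply: eq_bigr => j _; rewrite mulrC.
have [/zero->|a1] := eqVneq (enorm x) 0; first by rewrite mulr_ge0.
have [/zero b1|b1] := eqVneq (enorm y) 0; first by rewrite dotC b1 mulr_ge0.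
have := dotv_ge0 (enorm y *: x + (- enorm x) *: y).
rewrite dotv_combination -!enorm_sqr.
have ab : 0 < enorm x * enorm y by rewrite mulr_gt0// lt_def ?a1 ?b1.
by move=> H; rewrite -subr_ge0 -(pmulr_rge0 _ ab); lra.
Qed.

Lemma enormD x y : enorm (x + y) <= enorm x + enorm y.
Proof.
have ab : 0 <= enorm x + enorm y by rewrite addr_ge0// sqrtr_ge0.
rewrite -[leRHS](ger0_norm ab) -sqrtr_sqr ler_wsqrtr//.
have := dotv_combination 1 1 x y; rewrite !scale1r => ->.
have := dotv_le x y; rewrite -!enorm_sqr; lra.
Qed.

Lemma lip_enorm : lip 1 (@enorm R d).
Proof.
move=> x y; rewrite mul1r.
have H (u v : 'rV[R]_d) : enorm u - enorm v <= l1norm (u - v).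
  rewrite lerBlDr -{1}[u](subrK v); apply: le_trans (enormD _ _) _.
  by rewrite lerD2r enorm_le_l1norm.
by rewrite ler_norml H -(opprB (enorm y)) lerN2 l1normB H.
Qed.

Lemma ClLip_lip L (f : 'rV[R]_d -> R) : lip L f -> ClLip f.
Proof.
move=> fL; exists (`|L| * d%:R + 1), 0%N; split; first by rewrite ltr_wpDl// mulr_ge0.
move=> x y; apply: le_trans (fL x y) _.
rewrite !expr0.
have e0 : 0 <= enorm (x - y) := sqrtr_ge0 _.
have : L * l1norm (x - y) <= `|L| * (d%:R * enorm (x - y)).
  apply: (@le_trans _ _ (`|L| * l1norm (x - y))).
    by rewrite ler_wpM2r ?ler_norm ?l1norm_ge0.
  by rewrite ler_wpM2l ?l1norm_le_enorm.
have : 0 <= `|L| * (d%:R * enorm (x - y)) by rewrite !mulr_ge0.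
lra.
Qed.

Lemma CbLip_lip (f : 'rV[R]_d -> R) : CbLip f -> exists2 L, 0 <= L & lip L f.
Proof.
move=> [_ [L fL]]; exists `|L| => // x y; apply: le_trans (fL x y) _.
apply: (@le_trans _ _ (`|L| * enorm (x - y))).
  by rewrite ler_wpM2r ?ler_norm ?sqrtr_ge0.
by rewrite ler_wpM2l ?enorm_le_l1norm.
Qed.

Lemma lip_CbLip L B (f : 'rV[R]_d -> R) : lip L f -> (forall x, `|f x| <= B) -> CbLip f.
Proof.
move=> fL fB; split; first by exists B.
exists (`|L| * d%:R) => x y; apply: le_trans (fL x y) _.
rewrite -mulrA; apply: (@le_trans _ _ (`|L| * l1norm (x - y))).
  by rewrite ler_wpM2r ?ler_norm ?l1norm_ge0.
by rewrite ler_wpM2l ?l1norm_le_enorm.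
Qed.

End EuclideanNorm.

(** * Calculus of sublinear expectations *)

Section Expectation.
Context (R : realType) (S : sublinear_space R).
Implicit Types (X Y F : S -> R).

Lemma rvs_opp X : rvs X -> rvs (fun w => - X w).
Proof.
move=> /(rvs_scale (-1)); congr (rvs _).
by apply/funext => w; rewrite mulN1r.
Qed.

Lemma rvs_sum (I : Type) (s : seq I) (F : I -> S -> R) :
  (forall i, rvs (F i)) -> rvs (fun w => \sum_(i <- s) F i w).
Proof.
move=> hF; elim: s => [|i s IH].
  by under eq_fun do rewrite big_nil; exact: rvs_cst.
by under eq_fun do rewrite big_cons; exact: rvs_add.
Qed.

(** The product of two coordinates is in [ClLip] with exponent 1, so closure under composition
    applies to the pair (X, Y). *)
Lemma rvs_mul X Y : rvs X -> rvs Y -> rvs (fun w => X w * Y w).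
Proof.
move=> hX hY.
pose V (w : S) : 'rV[R]_2 := \row_j (if j == 0 then X w else Y w).
have -> : (fun w => X w * Y w) = (fun w => (fun v : 'rV[R]_2 => v 0 0 * v 0 1) (V w)).
  by apply/funext => w; rewrite !mxE.
apply: (@rvs_comp R S 2 V (fun v => v 0 0 * v 0 1)) => [j|].
  rewrite (_ : (fun w => V w 0 j) = if j == 0 then X else Y); first by case: ifP.
  by apply/funext => w; rewrite mxE; case: ifP.
exists 1, 1%N; split => // x y; rewrite !expr1 mul1r.
have -> : x 0 0 * x 0 1 - y 0 0 * y 0 1 =
    x 0 0 * (x - y) 0 1 + y 0 1 * (x - y) 0 0 by rewrite !mxE; ring.
apply: le_trans (ler_normD _ _) _; rewrite !normrM -addrA mulrDl mul1r mulrDl.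
have := enorm_coord x 0; have := enorm_coord y 1.
have := enorm_coord (x - y) 0; have := enorm_coord (x - y) 1 => h1 h2 h3 h4.
rewrite -[leLHS]add0r; apply: lerD; first exact: sqrtr_ge0.
by apply: lerD; apply: ler_pM.
Qed.

Lemma expectDc X (c : R) : rvs X -> expect (fun w => X w + c) = expect X + c.
Proof.
move=> hX; have hc := rvs_cst S; apply/eqP; rewrite eq_le; apply/andP; split.
  by rewrite -[X in _ <= _ + X](expect_cst S c); exact: expect_subadd.
rewrite -lerBrDr -[X in _ <= _ + X](expect_cst S (- c)).
apply: le_trans (expect_subadd _ _); [|exact: rvs_add|exact: hc].
by under [X in _ <= expect X]eq_fun do rewrite addrK.
Qed.

Lemma expect_dist X Y D : rvs X -> rvs Y -> rvs D -> (forall w, `|X w - Y w| <= D w) ->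
  `|expect X - expect Y| <= expect D.
Proof.
have H F F' : rvs F -> rvs F' -> rvs D -> (forall w, `|F w - F' w| <= D w) ->
    expect F - expect F' <= expect D.
  move=> hF hF' hD FF; rewrite lerBlDl.
  apply: le_trans (expect_subadd hF' hD); apply: expect_mono => //; first exact: rvs_add.
  by move=> w; rewrite -lerBlDl; apply: le_trans (FF w); exact: ler_norm.
move=> hX hY hD XY; rewrite ler_norml H// lerNl opprB H// => w.
by rewrite distrC.
Qed.

Lemma expect_near X Y (b : R) : rvs X -> rvs Y -> (forall w, `|X w - Y w| <= b) ->
  `|expect X - expect Y| <= b.
Proof.
move=> hX hY XY; rewrite -(expect_cst S b).
by apply: expect_dist => //; exact: rvs_cst.
Qed.

Lemma expect_sum (I : Type) (s : seq I) (F : I -> S -> R) : (forall i, rvs (F i)) ->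
  expect (fun w => \sum_(i <- s) F i w) <= \sum_(i <- s) expect (F i).
Proof.
move=> hF; elim: s => [|i s IH].
  by under eq_fun do rewrite big_nil; rewrite big_nil expect_cst.
under eq_fun do rewrite big_cons; rewrite big_cons.
apply: le_trans (expect_subadd _ _) _ => //; first exact: rvs_sum.
by rewrite lerD2l.
Qed.

End Expectation.

Section RandomVector.
Context (R : realType) (S : sublinear_space R) (d : nat).
Implicit Types (X : S -> 'rV[R]_d) (f : 'rV[R]_d -> R).

Lemma rv_affine X x (c : R) : random_vector X -> random_vector (fun w => x + c *: X w).
Proof.
move=> hX j; under eq_fun do rewrite !mxE.
by apply: rvs_add; [exact: rvs_cst|apply: rvs_scale; exact: hX].
Qed.

Lemma rvs_lip X L f : random_vector X -> lip L f -> rvs (fun w => f (X w)).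
Proof. by move=> hX /ClLip_lip; exact: rvs_comp. Qed.

Lemma rvs_l1norm X k : random_vector X -> rvs (fun w => l1norm (X w) ^+ k).
Proof.
move=> hX; elim: k => [|k IH].
  by under eq_fun do rewrite expr0; exact: rvs_cst.
under eq_fun do rewrite exprS; apply: rvs_mul => //.
by apply: rvs_sum => j; apply: rvs_abs; exact: hX.
Qed.

Lemma rvs_quadf X A : random_vector X -> rvs (fun w => quadf A (X w)).
Proof.
move=> hX; under eq_fun do rewrite quadfE.
apply: rvs_sum => i; apply: rvs_sum => j; apply: rvs_scale.
by apply: rvs_mul; exact: hX.
Qed.

Lemma expect_l1norm3 X (M : R) : random_vector X ->
  expect (fun w => enorm (X w) ^+ 3) <= M ->
  expect (fun w => l1norm (X w) ^+ 3) <= d%:R ^+ 3 * M.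
Proof.
move=> hX XM.
have he : rvs (fun w => enorm (X w) ^+ 3).
  have h := rvs_lip hX (@lip_enorm R d).
  under eq_fun do rewrite exprS expr2.
  by apply: rvs_mul => //; exact: rvs_mul.
apply: (@le_trans _ _ (d%:R ^+ 3 * expect (fun w => enorm (X w) ^+ 3))); last first.
  by rewrite ler_wpM2l// exprn_ge0.
rewrite -expect_poshom ?exprn_ge0//; apply: expect_mono; first exact: rvs_scale.
  exact: rvs_l1norm.
move=> w; rewrite -exprMn ler_pXn2r ?nnegrE ?l1norm_ge0 ?l1norm_le_enorm//.
by rewrite mulr_ge0 ?sqrtr_ge0.
Qed.

End RandomVector.

(** * The one-step operators and their second-order expansion *)

(** All clauses are restricted to Lipschitz functions, for which f(x + c X) is known to be in [rvs].
    [op_lip] preserves the constant, so iteration does not degrade it; [op_avg] encodes sublinearity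
    together with translation invariance. *)
Record sublinear_operator (R : realType) (d : nat)
    (U : ('rV[R]_d -> R) -> 'rV[R]_d -> R) : Prop := SublinearOperator {
  op_lip : forall L f, lip L f -> lip L (U f);
  op_mono : forall L1 L2 f g, lip L1 f -> lip L2 g -> (forall x, f x <= g x) ->
    forall x, U f x <= U g x;
  op_addc : forall L f c x, lip L f -> U (fun y => f y + c) x = U f x + c;
  op_avg : forall L f l x, lip L f -> (0 < size l)%N -> U (avg l f) x <= avg l (U f) x
}.

Definition translate (R : realType) (S : sublinear_space R) (d : nat)
    (c : R) (X : S -> 'rV[R]_d) (f : 'rV[R]_d -> R) (x : 'rV[R]_d) : R :=
  expect (fun w => f (x + c *: X w)).

Definition centered (R : realType) (S : sublinear_space R) (d : nat)
    (X : S -> 'rV[R]_d) : Prop :=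
  forall j, expect (fun w => X w 0 j) = 0 /\ expect (fun w => - X w 0 j) = 0.

Section Translate.
Context (R : realType) (S : sublinear_space R) (d : nat).
Variables (X : S -> 'rV[R]_d).
Hypothesis hX : random_vector X.

Lemma rvs_translate L f x c : lip L f -> rvs (fun w => f (x + c *: X w)).
Proof. by apply: rvs_lip; exact: rv_affine. Qed.

Lemma sublinear_translate c : sublinear_operator (translate c X).
Proof.
split.
- move=> L f fL x y; apply: expect_near; [exact: rvs_translate fL..|].
  by move=> w; apply: le_trans (fL _ _) _; rewrite [y + _ *: _]addrC addrKA.
- move=> L1 L2 f g fL gL fg x; apply: expect_mono => //; exact: rvs_translate.
- by move=> L f b x fL; rewrite /translate expectDc//; exact: rvs_translate fL.
move=> L f l x fL l0; rewrite /translate /avg.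
have hl a : rvs (fun w => f (x + a + c *: X w)) by exact: rvs_translate fL.
have -> : (fun w => (size l)%:R^-1 * \sum_(a <- l) f (x + c *: X w + a)) =
    (fun w => (size l)%:R^-1 * \sum_(a <- l) f (x + a + c *: X w)).
  by apply/funext => w; congr (_ * _); apply: eq_bigr => a _; rewrite addrAC.
rewrite expect_poshom ?invr_ge0//; last exact: rvs_sum.
by rewrite ler_wpM2l ?invr_ge0//; exact: expect_sum.
Qed.

Hypothesis X0 : centered X.
Variable m : R.
Hypothesis Xm : expect (fun w => l1norm (X w) ^+ 3) <= m.

Lemma rvs_linear (p : 'I_d -> R) : rvs (fun w => \sum_j p j * X w 0 j).
Proof. by apply: rvs_sum => j; apply: rvs_scale; exact: hX. Qed.

(** By subadditivity it suffices to treat each coordinate; the sign of p j decides whether the mean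
    of X_j or that of -X_j is used. *)
Lemma expect_linear_le0 (p : 'I_d -> R) : expect (fun w => \sum_j p j * X w 0 j) <= 0.
Proof.
apply: le_trans (expect_sum _ _) _ => [j|]; first by apply: rvs_scale; exact: hX.
apply: sumr_le0 => j _; have [Xj0 XNj0] := X0 j.
case: (leP 0 (p j)) => pj; first by rewrite expect_poshom// ?Xj0 ?mulr0.
under eq_fun do rewrite -mulrNN.
rewrite expect_poshom ?XNj0 ?mulr0//; first by apply: rvs_opp.
by rewrite oppr_ge0 ltW.
Qed.

(** Although the expectation is not linear, centering removes linear terms from upper bounds, and
    the cubic term is paid for by the third moment. *)
Lemma expect_le_perturb (F F' : S -> R) (p : 'I_d -> R) (a b : R) : rvs F -> rvs F' -> 0 <= a ->
    (forall w, F w <= F' w + \sum_j p j * X w 0 j + a * l1norm (X w) ^+ 3 + b) ->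
  expect F <= expect F' + a * m + b.
Proof.
move=> hF hF' a0 FF'.
have hl := rvs_linear p.
have hn : rvs (fun w => a * l1norm (X w) ^+ 3) by apply: rvs_scale; exact: rvs_l1norm.
have hFl : rvs (fun w => F' w + \sum_j p j * X w 0 j) by exact: rvs_add.
have hFln : rvs (fun w => F' w + \sum_j p j * X w 0 j + a * l1norm (X w) ^+ 3).
  exact: rvs_add.
apply: le_trans (expect_mono _ hF FF') _.
  by apply: rvs_add => //; exact: rvs_cst.
rewrite expectDc// lerD2r; apply: le_trans (expect_subadd hFl hn) _.
apply: lerD.
  apply: le_trans (expect_subadd hF' hl) _.
  by rewrite gerDl expect_linear_le0.
rewrite expect_poshom//; first by rewrite ler_wpM2l.
exact: rvs_l1norm.
Qed.

(** Insert c X in the expansion of [f] and apply [expect_le_perturb] in both directions, with linear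
    terms of opposite sign. *)
Lemma translate_taylor L f x (p : 'I_d -> R) (H : 'M[R]_d) (K kappa c : R) :
    lip L f -> 0 <= K -> 0 <= kappa -> 0 <= c ->
    (forall y, `|f (x + y) - f x - \sum_j y 0 j * p j - 2^-1 * quadf H y|
       <= K * l1norm y ^+ 3 + kappa * (1 + l1norm y ^+ 3)) ->
  `|translate c X f x - f x - c ^+ 2 * Gfun X H| <= (K + kappa) * c ^+ 3 * m + kappa.
Proof.
move=> fL K0 k0 c0 fH.
have hf := rvs_translate x c fL.
have hq := rvs_quadf H hX.
have a0 : 0 <= (K + kappa) * c ^+ 3 by rewrite mulr_ge0 ?addr_ge0 ?exprn_ge0.
have h2 : 0 <= c ^+ 2 * 2^-1 by rewrite mulr_ge0 ?sqr_ge0 ?invr_ge0.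
have Hw w : `|f (x + c *: X w) - f x - \sum_j (c * p j) * X w 0 j
     - c ^+ 2 * 2^-1 * quadf H (X w)|
    <= (K + kappa) * c ^+ 3 * l1norm (X w) ^+ 3 + kappa.
  have := fH (c *: X w); rewrite l1normZ (ger0_norm c0) exprMn.
  have -> : \sum_j (c *: X w) 0 j * p j = \sum_j (c * p j) * X w 0 j.
    by apply: eq_bigr => j _; rewrite mxE mulrAC.
  have -> : 2^-1 * quadf H (c *: X w) = c ^+ 2 * 2^-1 * quadf H (X w).
    rewrite !quadfE !mulr_sumr; apply: eq_bigr => i _; rewrite !mulr_sumr.
    by apply: eq_bigr => j _; rewrite !mxE; ring.
  by move/le_trans; apply; lra.
have E1 : expect (fun w => f (x + c *: X w)) <=
    expect (fun w => c ^+ 2 * 2^-1 * quadf H (X w)) + (K + kappa) * c ^+ 3 * m + (f x + kappa).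
  apply: (@expect_le_perturb _ _ (fun j => c * p j)) => //; first exact: rvs_scale.
  by move=> w; have := Hw w; rewrite ler_norml; lra.
have E2 : expect (fun w => c ^+ 2 * 2^-1 * quadf H (X w)) <=
   expect (fun w => f (x + c *: X w)) + (K + kappa) * c ^+ 3 * m + (kappa - f x).
  apply: (@expect_le_perturb _ _ (fun j => - (c * p j))) => //; first exact: rvs_scale.
  move=> w; under eq_bigr do rewrite mulNr.
  by rewrite sumrN; have := Hw w; rewrite ler_norml; lra.
rewrite /translate /Gfun mulrA; rewrite expect_poshom// in E1 E2.
by rewrite ler_norml; lra.
Qed.

(** The two forms differ by at most t n^2 <= t (1 + n^3), with n the l1 norm of X; the third moment
    controls this. *)
Lemma Gfun_near (A B : 'M[R]_d) (t : R) : 0 <= t -> (forall i j, `|A i j - B i j| <= t) ->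
  `|Gfun X A - Gfun X B| <= t * (1 + m).
Proof.
have half (C D : 'M[R]_d) : 0 <= t -> (forall i j, `|C i j - D i j| <= t) ->
    expect (fun w => quadf C (X w)) <= expect (fun w => quadf D (X w)) + t * m + t.
  move=> t0 CD; apply: (@expect_le_perturb _ _ (fun=> 0)) => //; try exact: rvs_quadf.
  move=> w; rewrite big1 ?addr0; last by move=> j _; rewrite mul0r.
  set n := l1norm (X w); have n0 : 0 <= n := l1norm_ge0 _.
  have : quadf C (X w) - quadf D (X w) <= t * n ^+ 2.
    rewrite !quadfE -sumrB expr2 {1}/n /l1norm mulr_suml mulr_sumr.
    apply: ler_sum => i _; rewrite -sumrB mulr_sumr mulr_sumr; apply: ler_sum => j _.
    by rewrite -mulrBl; apply: le_trans (ler_norm _) _; rewrite !normrM ler_wpM2r// mulr_ge0.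
  have nn : 0 <= (1 - n) ^+ 2 * (1 + n) by rewrite mulr_ge0 ?sqr_ge0 ?addr_ge0.
  have : t * n ^+ 2 <= t * (1 + n ^+ 3) by rewrite ler_wpM2l//; lra.
  lra.
move=> t0 AB; have h1 := half _ _ t0 AB.
have m0 : 0 <= t * m + t.
  have m0 : 0 <= m.
    apply: le_trans Xm; rewrite -[leLHS](expect_cst S 0).
    apply: expect_mono; [exact: rvs_l1norm|exact: rvs_cst|] => w.
    by rewrite exprn_ge0// l1norm_ge0.
  by rewrite addr_ge0// mulr_ge0.
have /half-/(_ t0) h2 : forall i j, `|B i j - A i j| <= t by move=> i j; rewrite distrC.
by rewrite /Gfun -mulrBr ler_norml; lra.
Qed.

End Translate.

(** * Comparison of compositions of sublinear operators *)

(** The operator with the largest index acts first on [f], just as independence integrates out the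
    last vector first. *)
Fixpoint compose (T : Type) (U : nat -> T -> T) (n : nat) (f : T) : T :=
  if n is k.+1 then compose U k (U k f) else f.

Section Comparison.
Context (R : realType) (d : nat).
Implicit Types (U V : nat -> ('rV[R]_d -> R) -> 'rV[R]_d -> R) (f g : 'rV[R]_d -> R).

Lemma lip_addc L f (c : R) : lip L f -> lip L (fun x => f x + c).
Proof. by move=> fL x y; rewrite opprD addrACA subrr addr0. Qed.

Lemma sublinear_compose U n : (forall i, sublinear_operator (U i)) ->
  sublinear_operator (compose U n).
Proof.
move=> hU; elim: n => [|n [nL nM nA nV]] /=; first by split.
have [UL UM UA UV] := hU n; split.
- by move=> L f fL; apply: nL; exact: UL.
- move=> L1 L2 f g fL gL fg; apply: (nM L1 L2); [exact: UL|exact: UL|].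
  exact: (UM L1 L2).
- move=> L f c x fL; rewrite -(nA L); last exact: UL.
  by congr (compose U n _ x); apply/funext => y; exact: UA fL.
move=> L f l x fL l0.
apply: le_trans (nV L _ _ _ _ _) => //; last exact: UL.
apply: (nM L L) => [||y]; last exact: UV fL l0.
- by apply: UL; exact: lip_avg.
- by apply: lip_avg => //; exact: UL.
Qed.

(* At each step sublinearity moves the average outside [V], so that it is again
   innermost for the next [U i]: [U] and [V] only have to be compared on
   averaged functions. *)
Lemma comparison U V (l : seq 'rV[R]_d) (L r : R) (delta : nat -> R) n f x :
    (forall i, sublinear_operator (U i)) -> (forall i, sublinear_operator (V i)) ->
    0 <= L -> (0 < size l)%N -> (forall a, a \in l -> l1norm a <= r) ->
    (forall i f x, lip L f -> U i (avg l f) x <= V i (avg l f) x + delta i) ->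
    lip L f ->
  compose U n f x <= compose V n f x + \sum_(i < n) delta i + 2 * (L * r).
Proof.
move=> hU hV L0 l0 lr UV fL.
have main k g y : lip L g ->
    compose U k (avg l g) y <= avg l (compose V k g) y + \sum_(i < k) delta i.
  elim: k g y => [|k IH] g y gL /=; first by rewrite big_ord0 addr0.
  have VL : lip L (V k g) by apply: (op_lip (hV k)).
  have [nL nM nA nV] := sublinear_compose k hU.
  have aL := lip_avg l0 VL.
  apply: (@le_trans _ _ (compose U k (fun z => avg l (V k g) z + delta k) y)).
    apply: (nM L L).
    - by apply: (op_lip (hU k)); exact: lip_avg.
    - exact: lip_addc.
    move=> z; apply: le_trans (UV _ _ _ gL) _; rewrite lerD2r.
    exact: (op_avg (hV k) _ gL).
  by rewrite (nA L)// big_ord_recr /= addrA lerD2r; exact: IH.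
have [nL nM nA nV] := sublinear_compose n hU.
have close g y : lip L g -> `|avg l g y - g y| <= L * r.
  by move=> gL; apply: avg_close.
have aL := lip_avg l0 fL.
(* Inserting the average at the start and removing it at the end cost [L * r] each. *)
have h1 : compose U n f x <= compose U n (avg l f) x + L * r.
  rewrite -(nA L)//; apply: (nM L L) => //; first exact: lip_addc.
  by move=> z; have := close f z fL; rewrite ler_norml; lra.
have h2 := main n f x fL.
have := close _ x (op_lip (sublinear_compose n hV) fL).
rewrite ler_norml; lra.
Qed.

End Comparison.

(** * The one-sided asymptotic comparison of two chains *)

Section OneSided.
Context (R : realType) (d : nat).

Lemma Gfun_bound (S : sublinear_space R) (X : S -> 'rV[R]_d) (m K : R) (H : 'M[R]_d) :
    random_vector X -> centered X -> expect (fun w => l1norm (X w) ^+ 3) <= m ->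
    0 <= K -> (forall i j, `|H i j| <= K) ->
  `|Gfun X H| <= K * (1 + m).
Proof.
move=> hX X0 Xm K0 HK.
have := @Gfun_near R S d X hX X0 m Xm H 0 K K0.
rewrite [Gfun X 0](_ : _ = 0); last first.
  rewrite /Gfun (_ : (fun w => _) = fun=> 0) ?expect_cst ?mulr0//.
  apply/funext => w; rewrite quadfE big1// => i _; rewrite big1// => j _.
  by rewrite mxE mul0r.
by rewrite subr0; apply => i j; rewrite mxE subr0.
Qed.

(** Stated for two arbitrary centered sequences so that it can be applied with the roles exchanged.
    The choices are made in the order [r], [K], [i0], [n]: [K] must be fixed before uniform
    closeness of the [Gfun] on matrices bounded by [K] is invoked. *)
Lemma translate_chain_le (S1 S2 : sublinear_space R)
    (X : nat -> S1 -> 'rV[R]_d) (Y : nat -> S2 -> 'rV[R]_d) (m L : R) f :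
    (forall i, random_vector (X i)) -> (forall i, random_vector (Y i)) ->
    (forall i, centered (X i)) -> (forall i, centered (Y i)) ->
    (forall i, expect (fun w => l1norm (X i w) ^+ 3) <= m) ->
    (forall i, expect (fun w => l1norm (Y i w) ^+ 3) <= m) ->
    (forall K eta, 0 < eta -> exists i0, forall i, (i0 <= i)%N ->
       forall H, symmx H -> (forall i j, `|H i j| <= K) ->
       `|Gfun (X i) H - Gfun (Y i) H| <= eta) ->
    0 <= L -> lip L f ->
  forall e, 0 < e -> exists n0, forall n, (n0 <= n)%N -> forall x,
    compose (fun i => translate (Num.sqrt n%:R)^-1 (X i)) n f x <=
    compose (fun i => translate (Num.sqrt n%:R)^-1 (Y i)) n f x + e.
Proof.
move=> hX hY X0 Y0 Xm Ym XY L0 fL e e0.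
have m0 : 0 <= m.
  apply: le_trans (Xm 0); rewrite -[leLHS](expect_cst S1 0).
  apply: expect_mono; [exact: rvs_l1norm|exact: rvs_cst|] => w.
  by rewrite exprn_ge0// l1norm_ge0.
pose r := e / (8 * (L + 1)).
have L1 : 0 < 8 * (L + 1) by rewrite mulr_gt0// ltr_wpDl.
have r0 : 0 < r by rewrite divr_gt0.
have Lr : 2 * (L * r) <= e / 4.
  rewrite /r !mulrA ler_pdivrMr//; have : 0 <= e * L by rewrite mulr_ge0// ltW.
  lra.
have [K K0 smooth] := smoothing d L0 r0.
have e4 : 0 < e / 4 by rewrite divr_gt0.
have [i0 Hi0] := XY K _ e4.
pose B := 2 * (K * (1 + m)).
have B0 : 0 <= B by rewrite !mulr_ge0 ?addr_ge0.
(* The finitely many indices below [i0] get only the crude bound [B]; each carries weight 1 / n. *)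
pose D i : R := if (i < i0)%N then B else e / 4.
have hD i H : symmx H -> (forall i j, `|H i j| <= K) ->
    `|Gfun (X i) H - Gfun (Y i) H| <= D i.
  move=> Hs HK; rewrite /D; case: ltnP => ii; last exact: Hi0.
  have := Gfun_bound (hX i) (X0 i) (Xm i) K0 HK.
  have := Gfun_bound (hY i) (Y0 i) (Ym i) K0 HK.
  by rewrite /B !ler_norml; lra.
(* [C] collects the coefficients of all errors of order n^(-1/2); the bound on [n] makes [C * c] at
   most e / 4. *)
pose C := i0%:R * B + 2 * ((K + 1) * m + 1).
have C0 : 0 < C.
  have : 0 <= i0%:R * B by rewrite mulr_ge0.
  have : 0 <= (K + 1) * m by rewrite mulr_ge0 ?addr_ge0.
  by rewrite /C; lra.
exists (Num.truncn ((4 * C / e) ^+ 2)).+1 => n hn x.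
have n0 : (0 < n)%N by exact: leq_trans hn.
have nR : 0 < n%:R :> R by rewrite ltr0n.
have q0 : 0 < Num.sqrt n%:R :> R by rewrite sqrtr_gt0.
set c := (Num.sqrt n%:R)^-1; have c0 : 0 < c by rewrite invr_gt0.
have c2 : c ^+ 2 = n%:R^-1 by rewrite exprVn sqr_sqrtr// ltW.
have nc2 : n%:R * c ^+ 2 = 1 by rewrite c2 divff// gt_eqF.
have Cc : C * c <= e / 4.
  have Ce : 0 <= 4 * C / e by rewrite divr_ge0 ?mulr_ge0 ?ltW.
  have : (4 * C / e) ^+ 2 <= n%:R.
    have /andP[_ /ltW] := truncn_itv (sqr_ge0 (4 * C / e)).
    by move/le_trans; apply; rewrite ler_nat.
  move/ler_wsqrtr; rewrite sqrtr_sqr ger0_norm// ler_pdivrMr// => h.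
  by rewrite /c ler_pdivrMr//; lra.
have c1 : c <= 1 by rewrite invf_le1// -[leLHS]sqrtr1 ler_wsqrtr// ler1n.
have c2c : c ^+ 2 <= c by rewrite expr2 ler_piMl// ltW.
(* With this choice, [n] smoothing errors [kappa] add up to [c], the same order as the cubic
   remainders. *)
pose kappa := c ^+ 3.
have kappa0 : 0 < kappa by rewrite exprn_gt0.
have k1 : kappa <= 1 by rewrite exprn_ile1// ltW.
have [l [l0 lr ltay]] := smooth _ kappa0.
pose delta i := c ^+ 2 * D i + 2 * ((K + 1) * m + 1) * c ^+ 3.
have hdelta i g y : lip L g -> translate c (X i) (avg l g) y <=
    translate c (Y i) (avg l g) y + delta i.
  move=> gL; have [p [H [Hs HK tay]]] := ltay g y gL.
  have tX := translate_taylor (hX i) (X0 i) (Xm i) (lip_avg l0 gL) K0 (ltW kappa0) (ltW c0) tay.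
  have tY := translate_taylor (hY i) (Y0 i) (Ym i) (lip_avg l0 gL) K0 (ltW kappa0) (ltW c0) tay.
  have : `|c ^+ 2 * (Gfun (X i) H - Gfun (Y i) H)| <= c ^+ 2 * D i.
    by rewrite normrM (ger0_norm (sqr_ge0 c)) ler_wpM2l ?sqr_ge0//; exact: hD.
  have : (K + kappa) * c ^+ 3 * m <= (K + 1) * m * c ^+ 3.
    by rewrite mulrAC ler_wpM2r ?ler_wpM2r ?lerD2l// ltW.
  move: tX tY; rewrite /delta -/kappa !ler_norml; lra.
have := comparison n x (fun i => sublinear_translate (hX i) c)
  (fun i => sublinear_translate (hY i) c) L0 l0 lr hdelta fL.
move/le_trans; apply; rewrite -addrA lerD2l.
have sD k : \sum_(i < k) D i <= i0%:R * B + k%:R * (e / 4).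
  elim: k => [|k IH]; first by rewrite big_ord0 mul0r addr0 mulr_ge0.
  have [ki|ki] := ltnP k i0.
    apply: (@le_trans _ _ (\sum_(i < k.+1) B)).
      apply: ler_sum => i _; rewrite /D ifT//.
      by apply: leq_ltn_trans ki; rewrite -ltnS.
    rewrite sumr_const card_ord -[leLHS]mulr_natl.
    apply: ler_wpDr; first by rewrite mulr_ge0// ltW.
    by rewrite ler_wpM2r// ler_nat.
  rewrite big_ord_recr /= -(natr1 k) [D k]/D ltnNge ki /=; lra.
have -> : \sum_(i < n) delta i = c ^+ 2 * \sum_(i < n) D i
     + 2 * ((K + 1) * m + 1) * c * (n%:R * c ^+ 2).
  rewrite big_split /= -mulr_sumr sumr_const card_ord -[X in _ + X = _]mulr_natl.
  by congr (_ + _); ring.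
have : c ^+ 2 * \sum_(i < n) D i <= i0%:R * B * c + e / 4.
  apply: le_trans (ler_wpM2l (sqr_ge0 c) (sD n)) _.
  have : i0%:R * B * c ^+ 2 <= i0%:R * B * c by rewrite ler_wpM2l// mulr_ge0.
  have -> : c ^+ 2 * (i0%:R * B + n%:R * (e / 4)) =
     i0%:R * B * c ^+ 2 + (n%:R * c ^+ 2) * (e / 4) by ring.
  by rewrite nc2; lra.
by rewrite nc2; move: Cc; rewrite /C; lra.
Qed.

End OneSided.

(** * Independence turns the law of the sum into a composition of operators *)

Section Independence.
Context (R : realType).

Lemma l1norm_lsub (m n : nat) (v : 'rV[R]_(m + n)) : l1norm (lsubmx v) <= l1norm v.
Proof.
rewrite /l1norm big_split_ord /= ler_wpDr//; first by apply: sumr_ge0.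
by apply: ler_sum => j _; rewrite mxE.
Qed.

Lemma l1norm_rsub (m n : nat) (v : 'rV[R]_(m + n)) : l1norm (rsubmx v) <= l1norm v.
Proof.
rewrite /l1norm [leRHS]big_split_ord /= ler_wpDl//; first by apply: sumr_ge0.
by apply: ler_sum => j _; rewrite mxE.
Qed.

Lemma lip_lsub_rsub (m n d : nat) (f : 'rV[R]_d -> R) (L C D : R)
    (g : 'rV[R]_m -> 'rV[R]_d) (h : 'rV[R]_n -> 'rV[R]_d) : 0 <= L -> 0 <= C -> 0 <= D ->
    lip L f -> (forall u v, l1norm (g u - g v) <= C * l1norm (u - v)) ->
    (forall u v, l1norm (h u - h v) <= D * l1norm (u - v)) ->
  lip (L * (C + D)) (fun v : 'rV[R]_(m + n) => f (g (lsubmx v) + h (rsubmx v))).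
Proof.
move=> L0 C0 D0 fL gC hD u v; apply: le_trans (fL _ _) _.
rewrite -mulrA ler_wpM2l// opprD addrACA; apply: le_trans (l1normD _ _) _.
rewrite mulrDl; apply: lerD.
- apply: le_trans (gC _ _) _; rewrite ler_wpM2l//.
  by rewrite -linearB; exact: l1norm_lsub.
- apply: le_trans (hD _ _) _; rewrite ler_wpM2l//.
  by rewrite -linearB; exact: l1norm_rsub.
Qed.

(** This form serves both the partial sums, where [g] reads the sum off the concatenated history,
    and combinations of a G-normal vector with its copy. *)
Lemma independent_lip (S : sublinear_space R) (m n d : nat) (f : 'rV[R]_d -> R) (L C D : R)
    (g : 'rV[R]_m -> 'rV[R]_d) (h : 'rV[R]_n -> 'rV[R]_d)
    (X : S -> 'rV[R]_m) (Y : S -> 'rV[R]_n) : independent_from Y X ->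
    0 <= L -> 0 <= C -> 0 <= D ->
    lip L f -> (forall u v, l1norm (g u - g v) <= C * l1norm (u - v)) ->
    (forall u v, l1norm (h u - h v) <= D * l1norm (u - v)) ->
  expect (fun w => f (g (X w) + h (Y w))) =
  expect (fun w => expect (fun w' => f (g (X w) + h (Y w')))).
Proof.
move=> XY L0 C0 D0 fL gC hD.
have := XY _ (ClLip_lip (lip_lsub_rsub L0 C0 D0 fL gC hD)).
under eq_fun do rewrite row_mxKl row_mxKr.
by move=> ->; congr expect; apply/funext => w; under eq_fun do rewrite row_mxKl row_mxKr.
Qed.

Lemma l1norm_scaleB (d : nat) (c : R) (x u v : 'rV[R]_d) :
  l1norm (x + c *: u - (x + c *: v)) <= `|c| * l1norm (u - v).
Proof. by rewrite [x + _]addrC addrKA -scalerBr l1normZ. Qed.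

(** Undoes the flattening in [initial_vectors] to recover the partial sum. *)
Definition row_total (k d : nat) (v : 'rV[R]_(k * d)) : 'rV[R]_d :=
  \row_j \sum_(i < k) (vec_mx v) i j.

Lemma l1norm_row_total (k d : nat) (u v : 'rV[R]_(k * d)) :
  l1norm (row_total u - row_total v) <= l1norm (u - v).
Proof.
have -> : l1norm (u - v) = \sum_(j < d) \sum_(i < k) `|vec_mx (u - v) i j|.
  rewrite exchange_big pair_big /= /l1norm.
  rewrite (reindex _ (curry_mxvec_bij k d)) /=.
  by apply: eq_bigr => -[i j] _; rewrite [vec_mx _ _ _]mxE.
apply: ler_sum => j _; rewrite !mxE -sumrB; apply: le_trans (ler_norm_sum _ _ _) _.
by apply: ler_sum => i _; rewrite linearB !mxE.
Qed.

Lemma expect_sum_step (S : sublinear_space R) (d : nat) (X : nat -> S -> 'rV[R]_d)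
    (i : nat) (c L : R) (f : 'rV[R]_d -> R) :
    independent_from (X i.+1) (initial_vectors X i) -> 0 <= L -> lip L f ->
  expect (fun w => f (c *: \sum_(k < i.+2) X k w)) =
  expect (fun w => translate c (X i.+1) f (c *: \sum_(k < i.+1) X k w)).
Proof.
move=> XI L0 fL.
have rt w : row_total (initial_vectors X i w) = \sum_(k < i.+1) X k w.
  apply/rowP => j; rewrite mxE summxE; apply: eq_bigr => k _.
  by rewrite mxvecK mxE.
under eq_fun do rewrite big_ord_recr scalerDr -rt.
rewrite (@independent_lip S _ _ d f L `|c| `|c| (fun u => c *: row_total u)
  (fun v => c *: v) _ _ XI L0 (normr_ge0 c) (normr_ge0 c) fL).
- by congr expect; apply/funext => w; rewrite rt.
- move=> u v; rewrite -scalerBr l1normZ ler_wpM2l//; exact: l1norm_row_total.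
- by move=> u v; rewrite -scalerBr l1normZ.
Qed.

Lemma expect_sum_compose (S : sublinear_space R) (d : nat) (X : nat -> S -> 'rV[R]_d)
    (c L : R) (f : 'rV[R]_d -> R) (n : nat) :
    (forall i, random_vector (X i)) ->
    (forall i, independent_from (X i.+1) (initial_vectors X i)) -> 0 <= L -> lip L f ->
  expect (fun w => f (c *: \sum_(k < n) X k w)) =
  compose (fun i => translate c (X i)) n f 0.
Proof.
move=> hX XI L0; elim: n f => [|n IH] f fL /=.
  by under eq_fun do rewrite big_ord0 scaler0; rewrite expect_cst.
(* The first vector has no history, so a single summand is treated without independence. *)
case: n IH => [|n] IH.
  rewrite /= /translate; congr expect; apply/funext => w.
  by rewrite big_ord_recr big_ord0 /= !add0r.
rewrite (expect_sum_step _ (XI n) L0 fL); apply: IH.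
exact: (op_lip (sublinear_translate (hX _) c)).
Qed.

End Independence.

(** * G-normal vectors: semigroup property and vanishing mean *)

Section GNormal.
Context (R : realType) (S : sublinear_space R) (d : nat) (Z : S -> 'rV[R]_d).
Hypothesis hZ : G_normal Z.

Lemma translate_bound (X : S -> 'rV[R]_d) (c L B : R) f : random_vector X -> lip L f ->
  (forall x, `|f x| <= B) -> forall x, `|translate c X f x| <= B.
Proof.
move=> hX fL fB x; rewrite -[translate _ _ _ _]subr0 -(expect_cst S 0).
apply: expect_near; [exact: rvs_translate fL|exact: rvs_cst|].
by move=> w; rewrite subr0.
Qed.

(** Stability replaces sqrt(s + t) Z by sqrt(s) Z + sqrt(t) Zb; independence makes this an iterated
    expectation, and equality of laws replaces the inner copy by Z. Boundedness of [f] makes it a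
    legitimate test function for [same_law]. *)
Lemma translate_semigroup (s t L B : R) f x : 0 <= s -> 0 <= t -> 0 <= L ->
    lip L f -> (forall x, `|f x| <= B) ->
  translate (Num.sqrt s) Z (translate (Num.sqrt t) Z f) x =
  translate (Num.sqrt (s + t)) Z f x.
Proof.
move=> s0 t0 L0 fL fB; have [rZ [Zb [[rZb ZbZ ZbI] law]]] := hZ.
have fx (y : 'rV[R]_d) a : CbLip (fun v => f (y + a *: v)).
  apply: (@lip_CbLip _ _ (L * `|a|) B) => // u v.
  apply: le_trans (fL _ _) _; rewrite -mulrA ler_wpM2l//; exact: l1norm_scaleB.
have := law _ _ (sqrtr_ge0 s) (sqrtr_ge0 t) (fun v => f (x + v)).
rewrite !sqr_sqrtr// => H; rewrite [RHS]/translate -H {H}; last first.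
  by have := fx x 1; under eq_fun do rewrite scale1r.
under [X in _ = expect X]eq_fun do rewrite addrA.
rewrite (@independent_lip _ _ _ _ _ f L `|Num.sqrt s| `|Num.sqrt t|
  (fun u => x + Num.sqrt s *: u) (fun v => Num.sqrt t *: v) _ _ ZbI L0)//; first last.
- by move=> u v; rewrite -scalerBr l1normZ.
- by move=> u v; exact: l1norm_scaleB.
congr expect; apply/funext => w.
by rewrite (ZbZ (fun v => f (x + Num.sqrt s *: Z w + Num.sqrt t *: v))).
Qed.

Lemma compose_translate_G_normal (c L B : R) n f x : 0 <= c -> 0 <= L ->
    lip L f -> (forall x, `|f x| <= B) ->
  compose (fun=> translate c Z) n f x = translate (Num.sqrt (n%:R * c ^+ 2)) Z f x.
Proof.
move=> c0 L0; have [rZ _] := hZ; elim: n f x => [|n IH] f x fL fB /=.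
  rewrite mul0r sqrtr0 /translate; under eq_fun do rewrite scale0r addr0.
  by rewrite expect_cst.
rewrite IH; last 2 first.
- exact: (op_lip (sublinear_translate rZ c)).
- exact: translate_bound rZ fL fB.
have c2 : 0 <= c ^+ 2 by rewrite sqr_ge0.
have {2}-> : c = Num.sqrt (c ^+ 2) by rewrite sqrtr_sqr ger0_norm.
rewrite (translate_semigroup _ _ c2 L0 fL fB) ?mulr_ge0//.
by rewrite -(natr1 n) mulrDl mul1r.
Qed.

End GNormal.

(* [same_law] only tests bounded functions: the coordinate is truncated at
   height [k], the error being at most [E |X|^2 / k]. *)
Lemma same_law_coord (R : realType) (S1 S2 : sublinear_space R) (d : nat)
    (X1 : S1 -> 'rV[R]_d) (X2 : S2 -> 'rV[R]_d) (a : R) (j : 'I_d) :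
    random_vector X1 -> random_vector X2 -> same_law X1 X2 ->
  expect (fun w => a * X1 w 0 j) = expect (fun w => a * X2 w 0 j).
Proof.
move=> hX1 hX2 X12.
pose tr (k v : R) : R := Num.max (- k) (Num.min k v).
have trB k v : 0 <= k -> `|tr k v| <= k.
  move=> k0; rewrite /tr; case: (leP k v) => ?; case: (leP (- k) _) => ?;
    rewrite ler_norml; lra.
have trL k u v : `|tr k u - tr k v| <= `|u - v|.
  have n1 := ler_norm (u - v); have n2 := ler_norm (v - u); rewrite distrC in n2.
  rewrite /tr; case: (leP k u) => ?; case: (leP (- k) _) => ?;
    case: (leP k v) => ?; case: (leP (- k) _) => ?; rewrite ler_norml; lra.
have trE k v : 0 < k -> `|v - tr k v| <= v ^+ 2 / k.
  move=> k0; rewrite ler_pdivlMr// -real_normK ?num_real// expr2.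
  have [vk|kv] := lerP `|v| k; last first.
    apply: ler_pM => //; last exact: ltW; first exact: ltW.
    have n1 := ler_norm v; have n2 := ler_norm (- v); rewrite normrN in n2.
    move: kv; rewrite /tr ltr_normr => /orP[] ?; case: (leP k v) => ?;
      case: (leP (- k) _) => ?; rewrite ler_norml; lra.
  rewrite (_ : tr k v = v) ?subrr ?normr0 ?mul0r ?mulr_ge0//.
  by move: vk; rewrite /tr ler_norml => /andP[? ?]; rewrite min_r// max_r.
have trlip k : lip `|a| (fun v : 'rV[R]_d => tr k (a * v 0 j)).
  move=> u v; apply: le_trans (trL _ _ _) _; rewrite -mulrBr normrM ler_wpM2l//.
  by have := l1norm_coord (u - v) j; rewrite !mxE.
have approx (S : sublinear_space R) (X : S -> 'rV[R]_d) k : random_vector X -> 0 < k ->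
    `|expect (fun w => a * X w 0 j) - expect (fun w => tr k (a * X w 0 j))|
    <= expect (fun w => (a * X w 0 j) ^+ 2) / k.
  move=> hX k0.
  have hj : rvs (fun w => a * X w 0 j) by apply: rvs_scale; exact: hX.
  have h2 : rvs (fun w => (a * X w 0 j) ^+ 2).
    by under eq_fun do rewrite expr2; exact: rvs_mul.
  rewrite mulrC -expect_poshom ?invr_ge0 ?(ltW k0)//; apply: expect_dist => //.
  - exact: rvs_lip hX (trlip k).
  - exact: rvs_scale.
  - by move=> w; rewrite [leRHS]mulrC; exact: trE.
pose e1 := expect (fun w => a * X1 w 0 j); pose e2 := expect (fun w => a * X2 w 0 j).
pose B := expect (fun w => (a * X1 w 0 j) ^+ 2) + expect (fun w => (a * X2 w 0 j) ^+ 2).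
have close k : 0 < k -> `|e1 - e2| * k <= B.
  move=> k0; rewrite -ler_pdivlMr// mulrDl.
  have := approx _ _ k hX1 k0; have := approx _ _ k hX2 k0.
  rewrite (X12 (fun v => tr k (a * v 0 j))); last first.
    by apply: lip_CbLip (trlip k) _ => v; apply: trB; exact: ltW.
  rewrite -/e1 -/e2 !ler_norml; lra.
(* If the two values differed, k = (1 + |B|) / |e1 - e2| would violate [close]. *)
apply/eqP; rewrite -subr_eq0 -normr_le0 leNgt; apply/negP => e0.
have := close _ (divr_gt0 (ltr_pwDl ltr01 (normr_ge0 B)) e0).
rewrite mulrC divfK ?gt_eqF//; have := ler_norm B; lra.
Qed.

(** Stability with both weights 1 and independence give sqrt(2) m = m + m for m = E[a Z_j], hence m
    = 0; take a = 1 and a = -1. Coordinates are unbounded, whence [same_law_coord]. *)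
Lemma G_normal_centered (R : realType) (S : sublinear_space R) (d : nat)
  (Z : S -> 'rV[R]_d) : G_normal Z -> centered Z.
Proof.
move=> [rZ [Zb [[rZb ZbZ ZbI] law]]].
suff H (a : R) (j : 'I_d) : expect (fun w => a * Z w 0 j) = 0.
  move=> j; split.
    by rewrite -[RHS](H 1 j); congr expect; apply/funext => w; rewrite mul1r.
  by rewrite -[RHS](H (-1) j); congr expect; apply/funext => w; rewrite mulN1r.
set m := expect _.
have sZ : random_vector (fun w => Num.sqrt 2 *: Z w).
  by have := rv_affine 0 (Num.sqrt 2) rZ; under eq_fun do rewrite add0r.
have sZZ : random_vector (fun w => Z w + Zb w).
  by move=> i; under eq_fun do rewrite mxE; apply: rvs_add; [exact: rZ|exact: rZb].
have hj : rvs (fun w => a * Z w 0 j) by apply: rvs_scale; exact: rZ.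
have E1 : expect (fun w => a * (Z w + Zb w) 0 j) = Num.sqrt 2 * m.
  rewrite (@same_law_coord _ _ _ _ _ (fun w => Num.sqrt 2 *: Z w))//.
    rewrite /m -expect_poshom ?sqrtr_ge0//; congr expect; apply/funext => w.
    by rewrite mxE mulrCA.
  have := law 1 1 ler01 ler01; rewrite expr1n.
  by under eq_fun do rewrite !scale1r.
have alip : lip `|a| (fun v : 'rV[R]_d => a * v 0 j).
  move=> u v; rewrite -mulrBr normrM ler_wpM2l//.
  by have := l1norm_coord (u - v) j; rewrite !mxE.
have := @independent_lip R S d d d _ _ 1 1 id id _ _ ZbI (normr_ge0 a) ler01 ler01 alip.
rewrite /= E1 => E2.
have {E2} : Num.sqrt 2 * m = m + m.
  rewrite E2; last 2 first.
  - by move=> u v; rewrite mul1r.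
  - by move=> u v; rewrite mul1r.
  rewrite -[X in _ = _ + X]/(expect _) -expectDc//; congr expect; apply/funext => w.
  have hb : rvs (fun w' => a * Zb w' 0 j) by apply: rvs_scale; exact: rZb.
  rewrite addrC /m -(same_law_coord a j rZb rZ ZbZ) -expectDc//.
  by congr expect; apply/funext => w'; rewrite mxE mulrDr addrC.
move/eqP; rewrite -subr_eq0 -mulr2n -(mulr_natl m 2) -mulrBl mulf_eq0 => /orP[|/eqP//].
rewrite subr_eq0 => /eqP s2.
have : Num.sqrt 2 ^+ 2 = 2 :> R by rewrite sqr_sqrtr.
rewrite s2; lra.
Qed.

(** * Uniform convergence of the functions G_i, and the limit theorem *)

(** A compactness argument: by [Gfun_near] the functions are equi-Lipschitz, so pointwise
    convergence on a finite grid of matrices suffices. *)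
Lemma Gfun_cvg_uniform (R : realType) (d : nat) (S1 S2 : sublinear_space R)
    (X : nat -> S1 -> 'rV[R]_d) (Y : S2 -> 'rV[R]_d) (m : R) :
    (forall i, random_vector (X i)) -> random_vector Y ->
    (forall i, centered (X i)) -> centered Y ->
    (forall i, expect (fun w => l1norm (X i w) ^+ 3) <= m) ->
    expect (fun w => l1norm (Y w) ^+ 3) <= m ->
    (forall A, symmx A -> Gfun (X i) A @[i --> \oo] --> Gfun Y A) ->
  forall K eta, 0 < eta -> exists i0, forall i, (i0 <= i)%N ->
    forall H, symmx H -> (forall i j, `|H i j| <= K) ->
    `|Gfun (X i) H - Gfun Y H| <= eta.
Proof.
move=> hX hY X0 Y0 Xm Ym XY K eta eta0.
have m0 : 0 <= m.
  apply: le_trans Ym; rewrite -[leLHS](expect_cst S2 0).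
  apply: expect_mono; [exact: rvs_l1norm|exact: rvs_cst|] => w.
  by rewrite exprn_ge0// l1norm_ge0.
have m1 : 0 < 1 + m by lra.
(* The mesh [t] makes each of the two roundings to the grid cost eta / 3. *)
have [t [t0 te]] : exists t, 0 < t /\ t * (1 + m) = eta / 3.
  by exists (eta / 3 / (1 + m)); rewrite divfK ?gt_eqF// !divr_gt0.
pose N := (Num.truncn ((K + K) / t)).+1.
pose grid (B : 'M['I_N]_d) : 'M[R]_d := \matrix_(i, j) ((B i j)%:R * t - K).
have near_grid : \forall i \near \oo, forall B, symmx (grid B) ->
    `|Gfun (X i) (grid B) - Gfun Y (grid B)| <= eta / 3.
  apply: filter_forall => B; have [Bs|Bs] := pselect (symmx (grid B)); last by apply: nearW.
  have /cvgrPdist_le/(_ (eta / 3)) := XY _ Bs.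
  rewrite divr_gt0// => /(_ isT); apply: filterS => i h _.
  by rewrite distrC.
have [i0 _ Hi0] := near_grid; exists i0 => i ii H Hs HK.
pose idx (v : R) : 'I_N := inord (Num.truncn ((v + K) / t)).
pose B : 'M['I_N]_d := \matrix_(i, j) idx (H i j).
(* Rounding is entrywise by one function, so symmetry survives. *)
have Bs : symmx (grid B).
  by apply/matrixP => a b; rewrite !mxE -[H in RHS]Hs mxE.
have HB a b : `|H a b - grid B a b| <= t.
  have := HK a b; rewrite ler_norml => /andP[v1 v2].
  have v0 : 0 <= (H a b + K) / t by rewrite divr_ge0 ?(ltW t0)//; lra.
  have idxE : (idx (H a b) : nat) = Num.truncn ((H a b + K) / t).
    rewrite inordK// ltnS; apply: le_truncn.
    by rewrite ler_pM2r ?invr_gt0// lerD2r.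
  have /andP[] := truncn_itv v0; rewrite !mxE idxE.
  set k := Num.truncn _; rewrite ler_pdivlMr// ltr_pdivrMr// -(natr1 k) => w1 w2.
  by rewrite ler_norml; lra.
have hi := Hi0 i ii B Bs.
have hx := Gfun_near (hX i) (X0 i) (Xm i) (ltW t0) HB.
have hy := Gfun_near hY Y0 Ym (ltW t0) HB.
by move: hi hx hy; rewrite te !ler_norml; lra.
Qed.

(* [X i] is the (i + 1)-st term of the sequence. *)
Theorem corollary3p2 (R : realType) (d : nat) (S : sublinear_space R)
    (X : nat -> S -> 'rV[R]_d)
    (X_rv : forall i, random_vector (X i))
    (X_indep : forall i, independent_from (X i.+1) (initial_vectors X i))
    (X_mean0 : forall i j, expect (fun w => X i w 0 j) = 0 /\
                           expect (fun w => - X i w 0 j) = 0)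
    (M : R) (M_gt0 : 0 < M)
    (X_moment3 : forall i, expect (fun w => enorm (X i w) ^+ 3) <= M)
    (G : 'M[R]_d -> R) (G_sublin : sublinear_on_symmx G)
    (G_lim : forall A, symmx A -> Gfun (X i) A @[i --> \oo] --> G A)
    (S' : sublinear_space R) (Z : S' -> 'rV[R]_d) (Theta : set 'M[R]_d)
    (Z_normal : normal_law Z G Theta) :
  forall phi : 'rV[R]_d -> R, CbLip phi ->
    expect (fun w => phi ((Num.sqrt n%:R)^-1 *: \sum_(i < n) X i w))
      @[n --> \oo] --> expect (fun w => phi (Z w)).
Proof.
move=> phi hphi.
have [Zn ZG _] := Z_normal.
have [Z_rv _] := Zn.
have Z0 := G_normal_centered Zn.
have [L L0 phiL] := CbLip_lip hphi.
have [[B phiB] _] := hphi.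
(* A third-moment bound common to both chains; that of [Z] is a real number because [rvs] contains
   the cube of its norm. *)
pose m := Num.max (d%:R ^+ 3 * M) (expect (fun w => l1norm (Z w) ^+ 3)).
have Xm i : expect (fun w => l1norm (X i w) ^+ 3) <= m.
  by rewrite le_max (expect_l1norm3 (X_rv i) (X_moment3 i)).
have Zm : expect (fun w => l1norm (Z w) ^+ 3) <= m by rewrite le_max lexx orbT.
have XZ : forall K eta, 0 < eta -> exists i0, forall i, (i0 <= i)%N ->
    forall H, symmx H -> (forall i j, `|H i j| <= K) ->
    `|Gfun (X i) H - Gfun Z H| <= eta.
  apply: (Gfun_cvg_uniform X_rv Z_rv X_mean0 Z0 Xm Zm) => A As.
  by rewrite ZG//; exact: G_lim.
have ZX : forall K eta, 0 < eta -> exists i0, forall i, (i0 <= i)%N ->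
    forall H, symmx H -> (forall i j, `|H i j| <= K) ->
    `|Gfun Z H - Gfun (X i) H| <= eta.
  move=> K eta /(XZ K)[i0 h]; exists i0 => i ii H Hs HK.
  by rewrite distrC; exact: h.
apply/cvgrPdist_le => e e0.
have [n1 h1] := translate_chain_le X_rv (fun=> Z_rv) X_mean0 (fun=> Z0) Xm
  (fun=> Zm) XZ L0 phiL e0.
have [n2 h2] := translate_chain_le (fun=> Z_rv) X_rv (fun=> Z0) X_mean0
  (fun=> Zm) Xm ZX L0 phiL e0.
(* The 1 ensures n > 0, so that [n] steps of size n^(-1/2) compose to exactly one unit of time for
   [Z]. *)
exists (maxn 1 (maxn n1 n2)) => // n /=; rewrite !geq_max => /and3P[n0 nn1 nn2].
rewrite (expect_sum_compose _ _ X_rv X_indep L0 phiL).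
have -> : expect (fun w => phi (Z w)) =
    compose (fun=> translate (Num.sqrt n%:R)^-1 Z) n phi 0.
  rewrite (compose_translate_G_normal Zn _ _ _ L0 phiL phiB) ?invr_ge0 ?sqrtr_ge0//.
  rewrite exprVn sqr_sqrtr// divff ?pnatr_eq0 -?lt0n// sqrtr1 /translate.
  by congr expect; apply/funext => w; rewrite add0r scale1r.
have := h1 n nn1 0; have := h2 n nn2 0.
by rewrite ler_norml; lra.
Qed.
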